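(* (i) For any strictly symmetric monoidal abelian groupoid $\mathcal{M}$, there exist a commutative monoid $M$, a functor $\mathcal{A}:\mathbb{H}M\to \mathbf{Ab}$, a symmetric $3$-cocycle $h\in Z^3(M,\mathcal{A})$, and a symmetric monoidal equivalence $$\mathcal{S}(M,\mathcal{A},h)\simeq \mathcal{M}.$$ (ii) Let $M,M'$ be commutative monoids, let $\mathcal{A}:\mathbb{H}M\to\mathbf{Ab}$ and $\mathcal{A}':\mathbb{H}M'\to\mathbf{Ab}$ be functors, and let $h\in Z^3(M,\mathcal{A})$ and $h'\in Z^3(M',\mathcal{A}')$ be symmetric $3$-cocycles. Then there is a symmetric monoidal equivalence $$\mathcal{S}(M,\mathcal{A},h)\simeq \mathcal{S}(M',\mathcal{A}',h')$$ if and only if there exist an isomorphism of monoids $i:M\cong M'$ and a natural isomorphism $\psi:\mathcal{A}\cong \mathcal{A}'i$ such that $$[h]=\psi_*^{-1}i^*[h']\in H^3(M,\mathcal{A}).$$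
   Context: **Coefficients.** For a commutative monoid $M$ (written multiplicatively, unit $1$), $\mathbb{H}M$ is the category with object set $M$ and arrow set $M\times M$, where $(a,b):a\to ab$; composition is $(ab,c)(a,b)=(a,bc)$ and the identity of $a$ is $(a,1)$. A functor $\mathcal{A}:\mathbb{H}M\to\mathbf{Ab}$ to abelian groups thus consists of abelian groups $\mathcal{A}_a$ ($a\in M$) and homomorphisms $b_*:\mathcal{A}_a\to\mathcal{A}_{ab}$ ($a,b\in M$) with $b_*c_*=(bc)_*:\mathcal{A}_a\to\mathcal{A}_{abc}$ and $1_*=\mathrm{id}_{\mathcal{A}_a}$. **Symmetric cochains and $H^3$.** A symmetric $2$-cochain $g\in C^2(M,\mathcal{A})$ is a family $g(a,b)\in\mathcal{A}_{ab}$ ($a,b\in M$) with $g(a,b)=g(b,a)$ and $g(a,1)=0$. A symmetric $3$-cochain $h\in C^3(M,\mathcal{A})$ is a family $h(a,b,c)\in\mathcal{A}_{abc}$ with $h(c,b,a)+h(a,b,c)=0$, $h(a,b,c)+h(b,c,a)+h(c,a,b)=0$ and $h(a,b,1)=0$. These form abelian groups under pointwise addition. Put $$(\partial^2g)(a,b,c)=a_*g(b,c)-g(ab,c)+g(a,bc)-c_*g(a,b),$$ $$(\partial^3h)(a,b,c,d)=a_*h(b,c,d)-h(ab,c,d)+h(a,bc,d)-h(a,b,cd)+d_*h(a,b,c).$$ The group of symmetric $3$-cocycles is $Z^3(M,\mathcal{A})=\{h\in C^3(M,\mathcal{A}):\partial^3h=0\}$, the group of symmetric $3$-coboundaries is $B^3(M,\mathcal{A})=\partial^2(C^2(M,\mathcal{A}))$,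 and Grillet's third cohomology group is $H^3(M,\mathcal{A})= Z^3(M,\mathcal{A})/B^3(M,\mathcal{A})$; $[h]$ denotes the class of $h$. For a monoid homomorphism $i:M\to M'$ and $\mathcal{A}':\mathbb{H}M'\to\mathbf{Ab}$, the functor $\mathcal{A}'i:\mathbb{H}M\to\mathbf{Ab}$ has $(\mathcal{A}'i)_a=\mathcal{A}'_{ia}$ with $b_*$ given by $(ib)_*:\mathcal{A}'_{ia}\to\mathcal{A}'_{i(ab)}$. The map $i^*:H^3(M',\mathcal{A}')\to H^3(M,\mathcal{A}'i)$ is induced by $(i^*h')(a,b,c)=h'(ia,ib,ic)$. A natural isomorphism $\psi:\mathcal{A}\cong\mathcal{A}'i$ induces an isomorphism $\psi_*:H^3(M,\mathcal{A})\to H^3(M,\mathcal{A}'i)$ by $(\psi_*h)(a,b,c)=\psi_{abc}(h(a,b,c))$. **Strictly symmetric monoidal abelian groupoids.** A groupoid is a small category all of whose morphisms are invertible; it is abelian if $\mathrm{Aut}(x)$ is abelian for every object $x$. Additive notation is used: $0_x$ is the identity of $x$, $v+u$ is the composite of $u:x\to y$ followed by $v:y\to z$, and $-u$ is the inverse of $u$. A strictly symmetric monoidal abelian groupoid $\mathcal{M}=(\mathcal{M},\otimes,\mathrm{I},\boldsymbol{a},\boldsymbol{r},\boldsymbol{c})$ consists of an abelian groupoid $\mathcal{M}$, a functor $\otimes:\mathcal{M}\times\mathcal{M}\to\mathcal{M}$, an object $\mathrm{I}$, and natural isomorphisms $\boldsymbol{a}_{x,y,z}:(x\otimes y)\otimes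 z\to x\otimes(y\otimes z)$, $\boldsymbol{r}_x:x\otimes\mathrm{I}\to x$, $\boldsymbol{c}_{x,y}:x\otimes y\to y\otimes x$ such that, for all objects, - $\boldsymbol{a}_{x,y,z\otimes t}+\boldsymbol{a}_{x\otimes y,z,t}=(0_x\otimes\boldsymbol{a}_{y,z,t})+\boldsymbol{a}_{x,y\otimes z,t}+(\boldsymbol{a}_{x,y,z}\otimes0_t)$; - $(0_y\otimes\boldsymbol{c}_{x,z})+\boldsymbol{a}_{y,x,z}+(\boldsymbol{c}_{x,y}\otimes0_z)=\boldsymbol{a}_{y,z,x}+\boldsymbol{c}_{x,y\otimes z}+\boldsymbol{a}_{x,y,z}$; - $(0_x\otimes\boldsymbol{r}_y)+(0_x\otimes\boldsymbol{c}_{\mathrm{I},y})+\boldsymbol{a}_{x,\mathrm{I},y}=\boldsymbol{r}_x\otimes0_y$; - $\boldsymbol{c}_{y,x}+\boldsymbol{c}_{x,y}=0_{x\otimes y}$; - $\boldsymbol{c}_{x,x}=0_{x\otimes x}$. **Symmetric monoidal functors and equivalences.** A symmetric monoidal functor $(F,\varphi,\varphi_0):\mathcal{M}\to\mathcal{M}'$ between such groupoids is a functor $F:\mathcal{M}\to\mathcal{M}'$ with natural isomorphisms $\varphi_{x,y}:Fx\otimes Fy\to F(x\otimes y)$ and an isomorphism $\varphi_0:\mathrm{I}'\to F\mathrm{I}$ such that - $F\boldsymbol{a}_{x,y,z}+\varphi_{x\otimes y,z}+(\varphi_{x,y}\otimes0_{Fz})=\varphi_{x,y\otimes z}+(0_{Fx}\otimes\varphi_{y,z})+\boldsymbol{a}'_{Fx,Fy,Fz}$;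 - $F\boldsymbol{r}_x+\varphi_{x,\mathrm{I}}+(0_{Fx}\otimes\varphi_0)=\boldsymbol{r}'_{Fx}$; - $\varphi_{y,x}+\boldsymbol{c}'_{Fx,Fy}=F\boldsymbol{c}_{x,y}+\varphi_{x,y}$. A symmetric isomorphism $\theta:F\Rightarrow F'$ between symmetric monoidal functors is a natural isomorphism with $\theta_{x\otimes y}+\varphi_{x,y}=\varphi'_{x,y}+(\theta_x\otimes\theta_y)$ and $\theta_{\mathrm{I}}+\varphi_0=\varphi'_0$. A symmetric monoidal functor $F:\mathcal{M}\to\mathcal{M}'$ is a symmetric monoidal equivalence if there are a symmetric monoidal functor $F':\mathcal{M}'\to\mathcal{M}$ and symmetric isomorphisms $F'F\cong \mathrm{id}_{\mathcal{M}}$ and $FF'\cong \mathrm{id}_{\mathcal{M}'}$ (with the evident composition of symmetric monoidal functors). A symmetric monoidal equivalence is denoted $\simeq$. **The groupoid $\mathcal{S}(M,\mathcal{A},h)$.** Given a commutative monoid $M$, a functor $\mathcal{A}:\mathbb{H}M\to\mathbf{Ab}$ and $h\in Z^3(M,\mathcal{A})$, $\mathcal{S}(M,\mathcal{A},h)$ is the following strictly symmetric monoidal abelian groupoid. Its objects are the elements $a\in M$; there are no morphisms between different objects, and $\mathrm{Aut}(a)=\mathcal{A}_a$, with composition given by addition in $\mathcal{A}_a$. The tensor product is $a\otimes b=ab$ on objects and $u_a\otimes u_b=b_*u_a+a_*u_b\in\mathcal{A}_{ab}$ on morphisms $u_a\in\mathcal{A}_a$, $u_b\in\mathcal{A}_b$.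 The unit object is $\mathrm{I}=1$, and the constraints are $\boldsymbol{a}_{a,b,c}=h(a,b,c):(ab)c\to a(bc)$, $\boldsymbol{c}_{a,b}=0_{ab}:ab\to ba$, $\boldsymbol{r}_a=0_a:a1\to a$. *)

(* Defs.v *)
From HB Require Import structures.
From mathcomp Require Import all_boot ssralg ring_quotient.
From mathcomp Require Import boolp.

Set Implicit Arguments.
Unset Strict Implicit.
Unset Printing Implicit Defensive.

Import GRing.Theory.
Local Open Scope quotient_scope.
Local Open Scope group_scope.
Local Open Scope ring_scope.

Declare Scope hom_scope.
Delimit Scope hom_scope with hom.

HB.mixin Record Monoid_isCommutative M of Monoid M := {
  mulgC : commutative (@mul M)
}.

#[short(type="comMonoidType")]
HB.structure Definition ComMonoid := {M of Monoid M & Monoid_isCommutative M}.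

Section ComMonoidTheory.
Variable M : comMonoidType.
Implicit Types a b c d : M.
Local Open Scope group_scope.

Lemma mulgAC a b c : a * c * b = a * b * c.
Proof. by rewrite -!mulgA (mulgC c). Qed.

Lemma mulg_rot a b c : b * c * a = a * b * c.
Proof. by rewrite [LHS]mulgC mulgA. Qed.

Lemma mulg_rotl a b c : c * a * b = a * b * c.
Proof. by rewrite -mulgA [LHS]mulgC. Qed.

Lemma mulg_rev a b c : c * b * a = a * b * c.
Proof. by rewrite [LHS]mulgC (mulgC c) mulgA. Qed.

Lemma mulg_rot4 a b c d : b * c * d * a = a * b * c * d.
Proof. by rewrite [LHS]mulgC !mulgA. Qed.

Lemma mulgA4 a b c d : a * (b * c) * d = a * b * c * d.
Proof. by rewrite mulgA. Qed.
End ComMonoidTheory.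

(* A a and A b are distinct types when a and b are only provably equal, so   *)
(* elements are transported along a = b before being added or compared.       *)
Definition cast (T : Type) (A : T -> zmodType) (a b : T) (e : a = b) :
  A a -> A b := let: erefl := e in id.

Fact cast_is_zmod_morphism T (A : T -> zmodType) a b (e : a = b) :
  zmod_morphism (@cast T A a b e).
Proof. by case: b / e. Qed.
HB.instance Definition _ T (A : T -> zmodType) a b (e : a = b) :=
  GRing.isZmodMorphism.Build (A a) (A b) (@cast T A a b e)
    (cast_is_zmod_morphism e).

Lemma subr_sum4 (V : zmodType) (x y z t x' y' z' t' : V) :
  (x - x') - (y - y') + (z - z') - (t - t')
  = (x - y + z - t) - (x' - y' + z' - t').
Proof.
have D (p q r s : V) : (p - q) + (r - s) = (p + r) - (q + s).
  by rewrite opprD addrACA.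
have B (p q r s : V) : (p - q) - (r - s) = (p - r) - (q - s).
  by rewrite !opprD addrACA.
by rewrite (B x) (D _ _ z) (B _ _ t).
Qed.

Lemma subr_sum5 (V : zmodType) (x y z t u x' y' z' t' u' : V) :
  (x - x') - (y - y') + (z - z') - (t - t') + (u - u')
  = (x - y + z - t + u) - (x' - y' + z' - t' + u').
Proof. by rewrite subr_sum4 [in RHS]opprD addrACA. Qed.

Section CastTheory.
Variables (T : eqType) (A : T -> zmodType).

Lemma cast0 a b (e : a = b) : cast e (0 : A a) = 0.
Proof. exact: raddf0. Qed.

Lemma castN a b (e : a = b) (u : A a) : cast e (- u) = - cast e u.
Proof. exact: raddfN. Qed.

Lemma castD a b (e : a = b) (u v : A a) : cast e (u + v) = cast e u + cast e v.
Proof. exact: raddfD. Qed.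

Lemma castB a b (e : a = b) (u v : A a) : cast e (u - v) = cast e u - cast e v.
Proof. exact: raddfB. Qed.

Lemma cast_id a (e : a = a) (u : A a) : cast e u = u.
Proof. by rewrite (eq_irrelevance e erefl). Qed.

Lemma cast_irr a b (e f : a = b) (u : A a) : cast e u = cast f u.
Proof. by rewrite (eq_irrelevance e f). Qed.

Lemma cast_cast a b c (e : b = c) (f : a = b) (u : A a) :
  cast e (cast f u) = cast (etrans f e) u.
Proof. by case: c / e; case: b / f. Qed.

Lemma cast_fam (g : forall a, A a) a b (e : a = b) : cast e (g a) = g b.
Proof. by case: b / e. Qed.

Lemma cast_inj a b (e : a = b) : injective (@cast T A a b e).
Proof. by case: b / e. Qed.
End CastTheory.

(* Functors from the category with objects a : M and arrows (a, b) : a -> a * b *)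
(* to abelian groups, where (a * b, c) after (a, b) is (a, b * c): hmap b is   *)
(* the image b_* of (a, b).                                                    *)
Record hfunctor (M : comMonoidType) := HFunctor {
  hval :> M -> zmodType;
  hmap : forall a b : M, {additive hval a -> hval (a * b)%g};
  hmap1 : forall (a : M) (u : hval a), cast (mulg1 a) (hmap a 1%g u) = u;
  hmapM : forall (a b c : M) (u : hval a),
    hmap (a * b)%g c (hmap a b u) = cast (mulgA a b c) (hmap a (b * c)%g u)
}.
Arguments hmap {M h a} b.

Section HFunctorTheory.
Variables (M : comMonoidType) (A : hfunctor M).
Local Open Scope group_scope.

Lemma hmap_cast a a' b (e : a = a') (u : A a) :
  hmap b (cast e u) = cast (congr1 (mul^~ b) e) (hmap b u).
Proof. by case: a' / e. Qed.

Lemma cast_hmap_eq a b b' c (e : a * b = c) (f : a * b' = c) (u : A a) :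
  b = b' -> cast e (hmap b u) = cast f (hmap b' u).
Proof. by move=> eb; case: b' / eb f => f; apply: cast_irr. Qed.

Lemma hmap_mul a b c d e (p : a * b * c = d) (q : a * e = d) (u : A a) :
  b * c = e -> cast p (hmap c (hmap b u)) = cast q (hmap e u).
Proof. by move=> ee; rewrite hmapM cast_cast; apply: cast_hmap_eq. Qed.

Lemma hmap_comm a b c d (p : a * b * c = d) (q : a * c * b = d) (u : A a) :
  cast p (hmap c (hmap b u)) = cast q (hmap b (hmap c u)).
Proof. by rewrite !hmapM !cast_cast; apply/cast_hmap_eq/mulgC. Qed.

Lemma cast_hmap1 a b (e : a * 1 = b) (f : a = b) (u : A a) :
  cast e (hmap 1 u) = cast f u.
Proof.
by case: b / f e => e; rewrite cast_id -[RHS](hmap1 u); apply: cast_irr.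
Qed.

Lemma cast_fam2 (g : forall a b, A (a * b)) a b a' b' c
    (e : a * b = c) (f : a' * b' = c) :
  a = a' -> b = b' -> cast e (g a b) = cast f (g a' b').
Proof.
by move=> ea eb; case: a' / ea f => f; case: b' / eb f => f; apply: cast_irr.
Qed.

Lemma cast_fam3 (g : forall a b c, A (a * b * c)) a b c a' b' c' d
    (e : a * b * c = d) (f : a' * b' * c' = d) :
  a = a' -> b = b' -> c = c' -> cast e (g a b c) = cast f (g a' b' c').
Proof.
move=> ea eb ec; case: a' / ea f => f; case: b' / eb f => f.
by case: c' / ec f => f; apply: cast_irr.
Qed.
End HFunctorTheory.

Section Cohomology.
Variables (M : comMonoidType) (A : hfunctor M).
Implicit Types a b c d : M.
Local Open Scope group_scope.
Local Open Scope ring_scope.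

Record cochain2 := Cochain2 {
  cochain2_fun :> forall a b, A (a * b)%g;
  cochain2_sym : forall a b,
    cast (mulgC b a) (cochain2_fun b a) = cochain2_fun a b;
  cochain2_1 : forall a, cochain2_fun a 1%g = 0
}.

Record cochain3 := Cochain3 {
  cochain3_fun :> forall a b c, A (a * b * c)%g;
  cochain3_rev : forall a b c,
    cast (mulg_rev a b c) (cochain3_fun c b a) + cochain3_fun a b c = 0;
  cochain3_rot : forall a b c,
    cochain3_fun a b c + cast (mulg_rot a b c) (cochain3_fun b c a)
      + cast (mulg_rotl a b c) (cochain3_fun c a b) = 0;
  cochain3_1 : forall a b, cochain3_fun a b 1%g = 0
}.

Lemma cochain2P (g g' : cochain2) : (forall a b, g a b = g' a b) -> g = g'.
Proof.
case: g g' => [g g1 g2] [g' g1' g2'] /= eg.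
have {}eg : g = g'.
  apply: functional_extensionality_dep => a.
  by apply: functional_extensionality_dep => b.
by case: g' / eg g1' g2' => g1' g2'; congr Cochain2; apply: Prop_irrelevance.
Qed.

Lemma cochain3P (h h' : cochain3) :
  (forall a b c, h a b c = h' a b c) -> h = h'.
Proof.
case: h h' => [h h1 h2 h3] [h' h1' h2' h3'] /= eh.
have {}eh : h = h'.
  apply: functional_extensionality_dep => a.
  apply: functional_extensionality_dep => b.
  by apply: functional_extensionality_dep => c.
case: h' / eh h1' h2' h3' => h1' h2' h3'.
by congr Cochain3; apply: Prop_irrelevance.
Qed.

HB.instance Definition _ := gen_eqMixin cochain2.
HB.instance Definition _ := gen_choiceMixin cochain2.
HB.instance Definition _ := gen_eqMixin cochain3.
HB.instance Definition _ := gen_choiceMixin cochain3.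

Definition zero2 : cochain2.
Proof. by apply: (@Cochain2 (fun a b => 0)) => // a b; rewrite cast0. Defined.

Definition opp2 (g : cochain2) : cochain2.
Proof.
apply: (@Cochain2 (fun a b => - g a b)) => [a b|a].
  by rewrite castN cochain2_sym.
by rewrite cochain2_1 oppr0.
Defined.

Definition add2 (g g' : cochain2) : cochain2.
Proof.
apply: (@Cochain2 (fun a b => g a b + g' a b)) => [a b|a].
  by rewrite castD !cochain2_sym.
by rewrite !cochain2_1 addr0.
Defined.

Fact add2A : associative add2.
Proof. by move=> x y z; apply: cochain2P => a b /=; rewrite addrA. Qed.
Fact add2C : commutative add2.
Proof. by move=> x y; apply: cochain2P => a b /=; rewrite addrC. Qed.
Fact add20 : left_id zero2 add2.
Proof. by move=> x; apply: cochain2P => a b /=; rewrite add0r. Qed.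
Fact add2N : left_inverse zero2 opp2 add2.
Proof. by move=> x; apply: cochain2P => a b /=; rewrite addNr. Qed.
HB.instance Definition _ := GRing.isZmodule.Build cochain2 add2A add2C add20 add2N.

Definition zero3 : cochain3.
Proof.
by apply: (@Cochain3 (fun a b c => 0)) => // a b c; rewrite !cast0 !addr0.
Defined.

Definition opp3 (h : cochain3) : cochain3.
Proof.
apply: (@Cochain3 (fun a b c => - h a b c)) => [a b c|a b c|a b].
- by rewrite castN -opprD cochain3_rev oppr0.
- by rewrite !castN -!opprD cochain3_rot oppr0.
- by rewrite cochain3_1 oppr0.
Defined.

Definition add3 (h h' : cochain3) : cochain3.
Proof.
apply: (@Cochain3 (fun a b c => h a b c + h' a b c)) => [a b c|a b c|a b].
- by rewrite castD addrACA !cochain3_rev addr0.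
- by rewrite !castD [X in X + _]addrACA [LHS]addrACA !cochain3_rot addr0.
- by rewrite !cochain3_1 addr0.
Defined.

Fact add3A : associative add3.
Proof. by move=> x y z; apply: cochain3P => a b c /=; rewrite addrA. Qed.
Fact add3C : commutative add3.
Proof. by move=> x y; apply: cochain3P => a b c /=; rewrite addrC. Qed.
Fact add30 : left_id zero3 add3.
Proof. by move=> x; apply: cochain3P => a b c /=; rewrite add0r. Qed.
Fact add3N : left_inverse zero3 opp3 add3.
Proof. by move=> x; apply: cochain3P => a b c /=; rewrite addNr. Qed.
HB.instance Definition _ := GRing.isZmodule.Build cochain3 add3A add3C add30 add3N.

Definition partial2 (g : forall a b, A (a * b)%g) a b c : A (a * b * c)%g :=
  cast (mulg_rot a b c) (hmap a (g b c)) - g (a * b)%g c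
  + cast (mulgA a b c) (g a (b * c)%g) - hmap c (g a b).

Definition partial3 (h : forall a b c, A (a * b * c)%g) a b c d :
    A (a * b * c * d)%g :=
  cast (mulg_rot4 a b c d) (hmap a (h b c d)) - h (a * b)%g c d
  + cast (mulgA4 a b c d) (h a (b * c)%g d)
  - cast (mulgA (a * b)%g c d) (h a b (c * d)%g) + hmap d (h a b c).

Definition is_cocycle3 : {pred cochain3} :=
  fun h => `[< forall a b c d, partial3 h a b c d = 0 >].

Fact partial3B (h h' : cochain3) a b c d :
  partial3 (h - h') a b c d = partial3 h a b c d - partial3 h' a b c d.
Proof.
have E x y z : (h - h') x y z = h x y z - h' x y z by [].
by rewrite /partial3 !E !(raddfB (hmap _)) /= !castB subr_sum5.
Qed.

Fact is_cocycle3_zmod_closed : zmod_closed is_cocycle3.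
Proof.
split=> [|h h' /asboolP hZ /asboolP hZ']; apply/asboolP => a b c d.
  by rewrite -[0 : cochain3](subrr 0) partial3B subrr.
by rewrite partial3B hZ hZ' subrr.
Qed.
HB.instance Definition _ :=
  GRing.isZmodClosed.Build cochain3 is_cocycle3 is_cocycle3_zmod_closed.

Record cocycle3 := Cocycle3 {
  cocycle3_val :> cochain3;
  _ : cocycle3_val \in is_cocycle3
}.
HB.instance Definition _ := [isSub for cocycle3_val].
HB.instance Definition _ := [Choice of cocycle3 by <:].
HB.instance Definition _ := [SubChoice_isSubZmodule of cocycle3 by <:].

Lemma cocycle3P (h : cocycle3) a b c d : partial3 h a b c d = 0.
Proof. by case: h => h /= /asboolP. Qed.

Fact partial2B (g g' : cochain2) a b c :
  partial2 (g - g') a b c = partial2 g a b c - partial2 g' a b c.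
Proof.
have E x y : (g - g') x y = g x y - g' x y by [].
by rewrite /partial2 !E !(raddfB (hmap _)) /= !castB subr_sum4.
Qed.

(* The image of partial2, whose values are automatically cocycles. *)
Definition is_coboundary3 : {pred cocycle3} :=
  fun h => `[< exists g : cochain2, forall a b c, h a b c = partial2 g a b c >].

Fact is_coboundary3_zmod_closed : zmod_closed is_coboundary3.
Proof.
split=> [|h h' /asboolP[g hg] /asboolP[g' hg']]; apply/asboolP.
  by exists 0 => a b c; rewrite -[0 : cochain2](subrr 0) partial2B subrr.
exists (g - g') => a b c; rewrite partial2B -hg -hg' //.
Qed.
HB.instance Definition _ :=
  GRing.isZmodClosed.Build cocycle3 is_coboundary3 is_coboundary3_zmod_closed.

Definition H3 := Quotient.quot is_coboundary3.
HB.instance Definition _ := GRing.Zmodule.on H3.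
HB.instance Definition _ := EqQuotient.on H3.

Definition H3class (h : cocycle3) : H3 := \pi h.

Lemma H3classP (h h' : cocycle3) :
  H3class h = H3class h' <->
  exists g : cochain2, forall a b c, h a b c - h' a b c = partial2 g a b c.
Proof.
split=> [/eqP|hg].
  by rewrite /H3class -[_ == _]Quotient.idealrBE => /asboolP.
by apply/eqP; rewrite /H3class -[_ == _]Quotient.idealrBE; apply/asboolP.
Qed.
End Cohomology.

Section Pullback.
Variables (M M' : comMonoidType) (i : UMagmaMorphism.type M M').
Variable A' : hfunctor M'.
Local Open Scope group_scope.
Local Open Scope ring_scope.

Lemma gmulfM3 (a b c : M) : (i (a * b * c) = i a * i b * i c)%g.
Proof. by rewrite !gmulfM. Qed.

Definition pull_map (a b : M) : {additive A' (i a) -> A' (i (a * b)%g)} :=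
  GRing.Additive.clone _ _ (cast (esym (gmulfM a b)) \o hmap (i b)) _.

Lemma cast_comp (a b : M) (e : a = b) (u : A' (i a)) :
  cast (A := fun a => A' (i a)) e u = cast (congr1 i e) u.
Proof. by case: b / e. Qed.

Fact pull_map1 (a : M) (u : A' (i a)) :
  cast (A := fun a => A' (i a)) (mulg1 a) (pull_map a 1%g u) = u.
Proof.
have e : (i a * i 1 = i a)%g by rewrite gmulf1 mulg1.
rewrite cast_comp /= cast_cast (cast_irr _ e).
rewrite (cast_hmap_eq _ (mulg1 (i a)) _ gmulf1); exact: hmap1.
Qed.

Fact pull_mapM (a b c : M) (u : A' (i a)) :
  pull_map (a * b)%g c (pull_map a b u)
  = cast (A := fun a => A' (i a)) (mulgA a b c) (pull_map a (b * c)%g u).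
Proof.
rewrite cast_comp /= cast_cast hmap_cast cast_cast.
exact/hmap_mul/esym/gmulfM.
Qed.

Definition pullback : hfunctor M := HFunctor pull_map1 pull_mapM.

Lemma cast_pull (a b : M) (e : a = b) (u : A' (i a)) :
  cast (A := pullback) e u = cast (congr1 i e) u.
Proof. exact: cast_comp. Qed.

Lemma hmap_pull (a b : M) (u : A' (i a)) :
  hmap (h := pullback) b u = cast (esym (gmulfM a b)) (hmap (i b) u).
Proof. by []. Qed.

Definition pull_cochain3 (h : cochain3 A') : cochain3 pullback.
Proof.
apply: (@Cochain3 _ pullback
  (fun a b c => cast (esym (gmulfM3 a b c)) (h (i a) (i b) (i c)))).
- move=> a b c; rewrite cast_pull cast_cast.
  rewrite -[RHS](cast0 A' (esym (gmulfM3 a b c))).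
  rewrite -(cochain3_rev h) castD cast_cast; congr (_ + _); exact: (@cast_irr _ A').
- move=> a b c; rewrite !cast_pull !cast_cast.
  rewrite -[RHS](cast0 A' (esym (gmulfM3 a b c))).
  rewrite -(cochain3_rot h) !castD !cast_cast.
  by congr (_ + _ + _); exact: (@cast_irr _ A').
move=> a b; have e : (i a * i b * 1 = i (a * b * 1))%g.
  by rewrite gmulfM3 gmulf1.
rewrite (cast_fam3 (A := A') _ _ e erefl erefl gmulf1) cochain3_1; exact: (cast0 A').
Defined.

Lemma partial3_pull (h : cochain3 A') (a b c d : M) e :
  partial3 (pull_cochain3 h) a b c d
  = cast (e : i a * i b * i c * i d = i (a * b * c * d))%g
      (partial3 h (i a) (i b) (i c) (i d)).
Proof.
rewrite /partial3 !(castD, castN) !cast_cast.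
rewrite !cast_pull !hmap_pull /= !hmap_cast !cast_cast.
congr (_ - _ + _ - _ + _).
- exact: (@cast_irr _ A').
- by apply: (@cast_fam3 _ A'); rewrite ?gmulfM.
- by apply: (@cast_fam3 _ A'); rewrite ?gmulfM.
- by apply: (@cast_fam3 _ A'); rewrite ?gmulfM.
- exact: (@cast_irr _ A').
Qed.

Fact pull_cocycle3_subproof (h : cocycle3 A') :
  pull_cochain3 h \in @is_cocycle3 M pullback.
Proof.
apply/asboolP => a b c d; have e : (i a * i b * i c * i d = i (a * b * c * d))%g.
  by rewrite !gmulfM.
by rewrite (partial3_pull _ e) cocycle3P; apply: (cast0 A').
Qed.

Definition pull_cocycle3 (h : cocycle3 A') : cocycle3 pullback :=
  Cocycle3 (pull_cocycle3_subproof h).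

Definition pull_cochain2 (g : cochain2 A') : cochain2 pullback.
Proof.
apply: (@Cochain2 _ pullback
  (fun a b => cast (esym (gmulfM a b)) (g (i a) (i b)))).
- move=> a b; rewrite cast_pull cast_cast -(cochain2_sym g (i a)) cast_cast.
  exact: (@cast_irr _ A').
move=> a; have e : (i a * 1 = i (a * 1))%g by rewrite gmulfM gmulf1.
rewrite (cast_fam2 (A := A') _ _ e erefl gmulf1) cochain2_1; exact: (cast0 A').
Defined.

Lemma partial2_pull (g : cochain2 A') (a b c : M) :
  partial2 (pull_cochain2 g) a b c
  = cast (esym (gmulfM3 a b c)) (partial2 g (i a) (i b) (i c)).
Proof.
rewrite /partial2 !(castD, castN) !cast_cast.
rewrite !cast_pull !hmap_pull /= !hmap_cast !cast_cast.
congr (_ - _ + _ - _).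
- exact: (@cast_irr _ A').
- by apply: (@cast_fam2 _ A'); rewrite ?gmulfM.
- by apply: (@cast_fam2 _ A'); rewrite ?gmulfM.
- exact: (@cast_irr _ A').
Qed.

(* The map i^* on cohomology, defined on representatives: see H3_pullE. *)
Definition H3_pull (x : H3 A') : H3 pullback := H3class (pull_cocycle3 (repr x)).

Lemma H3_pullE (h : cocycle3 A') :
  H3_pull (H3class h) = H3class (pull_cocycle3 h).
Proof.
have /H3classP[g hg] : H3class (repr (H3class h)) = H3class h by exact: reprK.
apply/H3classP; exists (pull_cochain2 g) => a b c.
by rewrite partial2_pull -hg castB.
Qed.
End Pullback.

Record hiso (M : comMonoidType) (A B : hfunctor M) := HIso {
  hiso_fun :> forall a : M, {additive A a -> B a};
  hiso_inv : forall a : M, B a -> A a;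
  hiso_natural : forall (a b : M) (u : A a),
    hiso_fun (a * b)%g (hmap b u) = hmap b (hiso_fun a u);
  hisoK : forall a : M, cancel (hiso_fun a) (@hiso_inv a);
  hisoVK : forall a : M, cancel (@hiso_inv a) (hiso_fun a)
}.

Section HIsoSym.
Variables (M : comMonoidType) (A B : hfunctor M) (psi : hiso A B).
Local Open Scope group_scope.
Local Open Scope ring_scope.

Fact hiso_inv_zmod_morphism a : zmod_morphism (@hiso_inv _ _ _ psi a).
Proof. exact: can2_zmod_morphism (hisoK psi (a:=a)) (hisoVK psi (a:=a)). Qed.
HB.instance Definition _ a := GRing.isZmodMorphism.Build (B a) (A a)
  (@hiso_inv _ _ _ psi a) (@hiso_inv_zmod_morphism a).

Fact hiso_inv_natural (a b : M) (u : B a) :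
  hiso_inv psi (hmap b u) = hmap b (hiso_inv psi u).
Proof. by rewrite -[u in LHS](hisoVK psi) -hiso_natural hisoK. Qed.

Definition hiso_sym : hiso B A :=
  @HIso M B A (fun a => GRing.Additive.clone _ _ (@hiso_inv _ _ _ psi a) _)
    (fun a => psi a) hiso_inv_natural (hisoVK psi) (hisoK psi).
End HIsoSym.

Section Pushforward.
Variables (M : comMonoidType) (A B : hfunctor M) (psi : hiso A B).
Local Open Scope group_scope.
Local Open Scope ring_scope.

Lemma hiso_cast (a b : M) (e : a = b) (u : A a) :
  psi b (cast e u) = cast e (psi a u).
Proof. by case: b / e. Qed.

Definition push_cochain3 (h : cochain3 A) : cochain3 B.
Proof.
apply: (@Cochain3 _ B (fun a b c => psi _ (h a b c))) => [a b c|a b c|a b].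
- by rewrite -hiso_cast -raddfD cochain3_rev raddf0.
- by rewrite -!hiso_cast -!raddfD cochain3_rot raddf0.
- by rewrite cochain3_1 raddf0.
Defined.

Lemma partial3_push (h : cochain3 A) (a b c d : M) :
  partial3 (push_cochain3 h) a b c d = psi _ (partial3 h a b c d).
Proof.
by rewrite /partial3 !(raddfD (psi _), raddfN (psi _)) /= !hiso_cast !hiso_natural.
Qed.

Fact push_cocycle3_subproof (h : cocycle3 A) : push_cochain3 h \in @is_cocycle3 M B.
Proof. by apply/asboolP => a b c d; rewrite partial3_push cocycle3P raddf0. Qed.

Definition push_cocycle3 (h : cocycle3 A) : cocycle3 B :=
  Cocycle3 (push_cocycle3_subproof h).

Definition push_cochain2 (g : cochain2 A) : cochain2 B.
Proof.
apply: (@Cochain2 _ B (fun a b => psi _ (g a b))) => [a b|a].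
- by rewrite -hiso_cast cochain2_sym.
- by rewrite cochain2_1 raddf0.
Defined.

Lemma partial2_push (g : cochain2 A) (a b c : M) :
  partial2 (push_cochain2 g) a b c = psi _ (partial2 g a b c).
Proof.
by rewrite /partial2 !(raddfD (psi _), raddfN (psi _)) /= !hiso_cast !hiso_natural.
Qed.

(* The map psi_* on cohomology, defined on representatives: see H3_pushE. *)
Definition H3_push (x : H3 A) : H3 B := H3class (push_cocycle3 (repr x)).

Lemma H3_pushE (h : cocycle3 A) : H3_push (H3class h) = H3class (push_cocycle3 h).
Proof.
have /H3classP[g hg] : H3class (repr (H3class h)) = H3class h by exact: reprK.
apply/H3classP; exists (push_cochain2 g) => a b c.
by rewrite partial2_push -hg raddfB.
Qed.
End Pushforward.

Section PushInverse.
Variables (M : comMonoidType) (A B : hfunctor M) (psi : hiso A B).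

(* The inverse of psi_*: see H3_pushK and H3_pushVK. *)
Definition H3_pushV : H3 B -> H3 A := H3_push (hiso_sym psi).

Lemma H3_pushK : cancel (H3_push psi) H3_pushV.
Proof.
move=> x; rewrite -[x]reprK [H3_push _ _]H3_pushE [LHS]H3_pushE.
by congr H3class; apply/val_inj/cochain3P => a b c; apply: hisoK.
Qed.

Lemma H3_pushVK : cancel H3_pushV (H3_push psi).
Proof.
move=> x; rewrite -[x]reprK [H3_pushV _]H3_pushE [LHS]H3_pushE.
by congr H3class; apply/val_inj/cochain3P => a b c; apply: hisoVK.
Qed.
End PushInverse.

Record groupoid := Groupoid {
  gobj :> Type;
  hom : gobj -> gobj -> Type;
  idm : forall x, hom x x;
  addm : forall x y z, hom y z -> hom x y -> hom x z;
  oppm : forall x y, hom x y -> hom y x;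
  addmA : forall x y z t (w : hom z t) (v : hom y z) (u : hom x y),
    addm w (addm v u) = addm (addm w v) u;
  add0m : forall x y (u : hom x y), addm (idm y) u = u;
  addm0 : forall x y (u : hom x y), addm u (idm x) = u;
  addNm : forall x y (u : hom x y), addm (oppm u) u = idm x;
  addmN : forall x y (u : hom x y), addm u (oppm u) = idm y
}.
Arguments idm {g} x.

(* The group law of Aut(x) and the composition are both written additively:  *)
(* v + u is u followed by v.                                                 *)
Notation "\0_ x" := (idm x) (at level 8, x at level 2, format "\0_ x") : hom_scope.
Notation "v + u" := (addm v u) : hom_scope.
Notation "- u" := (oppm u) : hom_scope.

Definition abelian_groupoid (G : groupoid) : Prop :=
  forall (x : G) (u v : hom x x), (u + v = v + u)%hom.

Record smdata := SMData {
  smgpd :> groupoid;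
  tens : smgpd -> smgpd -> smgpd;
  tensm : forall x x' y y' : smgpd,
    hom x x' -> hom y y' -> hom (tens x y) (tens x' y');
  unito : smgpd;
  assoc : forall x y z : smgpd, hom (tens (tens x y) z) (tens x (tens y z));
  runit : forall x : smgpd, hom (tens x unito) x;
  comm : forall x y : smgpd, hom (tens x y) (tens y x)
}.
Arguments unito {s}.

Notation "x ⊗ y" := (tens x y) (at level 40, left associativity) : hom_scope.
Notation "u ⊠ v" := (tensm u v) (at level 40, left associativity) : hom_scope.

(* Here and below, natural isomorphisms between functors of groupoids are    *)
(* just natural families of arrows, since every arrow is invertible.         *)
Record strictly_symmetric (C : smdata) : Prop := StrictlySymmetric {
  tensm_id : forall x y : C, (\0_x ⊠ \0_y = \0_(x ⊗ y))%hom;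
  tensm_add : forall (x x' x'' y y' y'' : C) (u' : hom x' x'') (u : hom x x')
      (v' : hom y' y'') (v : hom y y'),
    ((u' + u) ⊠ (v' + v) = (u' ⊠ v') + (u ⊠ v))%hom;
  assoc_natural : forall (x x' y y' z z' : C) (u : hom x x') (v : hom y y')
      (w : hom z z'),
    (assoc x' y' z' + (u ⊠ v) ⊠ w = u ⊠ (v ⊠ w) + assoc x y z)%hom;
  runit_natural : forall (x x' : C) (u : hom x x'),
    (runit x' + u ⊠ \0_unito = u + runit x)%hom;
  comm_natural : forall (x x' y y' : C) (u : hom x x') (v : hom y y'),
    (comm x' y' + u ⊠ v = v ⊠ u + comm x y)%hom;
  pentagon : forall x y z t : C,
    (assoc x y (z ⊗ t) + assoc (x ⊗ y) z t
     = \0_x ⊠ assoc y z t + assoc x (y ⊗ z) t + assoc x y z ⊠ \0_t)%hom;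
  hexagon : forall x y z : C,
    (\0_y ⊠ comm x z + assoc y x z + comm x y ⊠ \0_z
     = assoc y z x + comm x (y ⊗ z) + assoc x y z)%hom;
  triangle : forall x y : C,
    (\0_x ⊠ runit y + \0_x ⊠ comm unito y + assoc x unito y
     = runit x ⊠ \0_y)%hom;
  comm_sym : forall x y : C, (comm y x + comm x y = \0_(x ⊗ y))%hom;
  comm_strict : forall x : C, (comm x x = \0_(x ⊗ x))%hom
}.

(* ssmag abbreviates strictly symmetric monoidal abelian groupoid. *)
Record ssmag := SSMAG {
  ssmag_data :> smdata;
  ssmag_abelian : abelian_groupoid ssmag_data;
  ssmag_axioms : strictly_symmetric ssmag_data
}.

Record functor (C D : groupoid) := Functor {
  fobj :> C -> D;
  fmap : forall x y : C, hom x y -> hom (fobj x) (fobj y);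
  fmap_id : forall x : C, (fmap \0_x = \0_(fobj x))%hom;
  fmap_add : forall (x y z : C) (v : hom y z) (u : hom x y),
    (fmap (v + u) = fmap v + fmap u)%hom
}.

Record smfunctor (C D : ssmag) := SMFunctor {
  smfun :> functor C D;
  phi : forall x y : C, hom (smfun x ⊗ smfun y)%hom (smfun (x ⊗ y)%hom);
  phi0 : hom unito (smfun unito);
  phi_natural : forall (x x' y y' : C) (u : hom x x') (v : hom y y'),
    (phi x' y' + fmap smfun u ⊠ fmap smfun v
     = fmap smfun (u ⊠ v) + phi x y)%hom;
  phi_assoc : forall x y z : C,
    (fmap smfun (assoc x y z) + phi (x ⊗ y) z + phi x y ⊠ \0_(smfun z)
     = phi x (y ⊗ z) + \0_(smfun x) ⊠ phi y z
       + assoc (smfun x) (smfun y) (smfun z))%hom;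
  phi_runit : forall x : C,
    (fmap smfun (runit x) + phi x unito + \0_(smfun x) ⊠ phi0
     = runit (smfun x))%hom;
  phi_comm : forall x y : C,
    (phi y x + comm (smfun x) (smfun y)
     = fmap smfun (comm x y) + phi x y)%hom
}.
Arguments phi {C D} s x y.
Arguments phi0 {C D} s.

Definition functor_id (C : groupoid) : functor C C :=
  @Functor C C id (fun _ _ => id) (fun _ => erefl) (fun _ _ _ _ _ => erefl).

Section FunctorComp.
Variables (C D E : groupoid) (G : functor D E) (F : functor C D).

Fact comp_fmap_id (x : C) : (fmap G (fmap F \0_x) = \0_(G (F x)))%hom.
Proof. by rewrite !fmap_id. Qed.

Fact comp_fmap_add (x y z : C) (v : hom y z) (u : hom x y) :
  (fmap G (fmap F (v + u)) = fmap G (fmap F v) + fmap G (fmap F u))%hom.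
Proof. by rewrite !fmap_add. Qed.

Definition functor_comp : functor C E :=
  @Functor C E (G \o F) (fun _ _ u => fmap G (fmap F u))
    comp_fmap_id comp_fmap_add.
End FunctorComp.

Section SMFunctorId.
Variable C : ssmag.

Definition smfunctor_id : smfunctor C C.
Proof.
apply: (@SMFunctor C C (functor_id C) (fun x y => idm _) (idm _)) => /=.
- by move=> x x' y y' u v; rewrite add0m addm0.
- move=> x y z; rewrite !(tensm_id (ssmag_axioms C)).
  by rewrite !(addm0, add0m).
- by move=> x; rewrite !(tensm_id (ssmag_axioms C)) !addm0.
- by move=> x y; rewrite addm0 add0m.
Defined.
End SMFunctorId.

Section SMFunctorComp.
Variables (C D E : ssmag) (G : smfunctor D E) (F : smfunctor C D).

Let gphi (x y : C) : hom (G (F x) ⊗ G (F y))%hom (G (F (x ⊗ y)))%hom :=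
  (fmap G (phi F x y) + phi G (F x) (F y))%hom.
Let gphi0 : hom unito (G (F unito)) := (fmap G (phi0 F) + phi0 G)%hom.

Lemma tensm_addl (x x' x'' y : E) (u' : hom x' x'') (u : hom x x') :
  ((u' + u) ⊠ \0_y = u' ⊠ \0_y + u ⊠ \0_y)%hom.
Proof. by rewrite -(tensm_add (ssmag_axioms E)) add0m. Qed.

Lemma tensm_addr (y x x' x'' : E) (u' : hom x' x'') (u : hom x x') :
  (\0_y ⊠ (u' + u) = \0_y ⊠ u' + \0_y ⊠ u)%hom.
Proof. by rewrite -(tensm_add (ssmag_axioms E)) add0m. Qed.

Fact comp_phi_natural (x x' y y' : C) (u : hom x x') (v : hom y y') :
  (gphi x' y' + fmap G (fmap F u) ⊠ fmap G (fmap F v)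
   = fmap G (fmap F (u ⊠ v)) + gphi x y)%hom.
Proof.
by rewrite /gphi -addmA phi_natural !addmA -!fmap_add phi_natural.
Qed.

Fact comp_phi_assoc (x y z : C) :
  (fmap G (fmap F (assoc x y z)) + gphi (x ⊗ y) z + gphi x y ⊠ \0_(G (F z))
   = gphi x (y ⊗ z) + \0_(G (F x)) ⊠ gphi y z
     + assoc (G (F x)) (G (F y)) (G (F z)))%hom.
Proof.
have EL : (phi G (F (x ⊗ y)) (F z) + fmap G (phi F x y) ⊠ \0_(G (F z))
    = fmap G (phi F x y ⊠ \0_(F z)) + phi G (F x ⊗ F y) (F z))%hom.
  by rewrite -fmap_id phi_natural.
have ER : (phi G (F x) (F (y ⊗ z)) + \0_(G (F x)) ⊠ fmap G (phi F y z)
    = fmap G (\0_(F x) ⊠ phi F y z) + phi G (F x) (F y ⊗ F z))%hom.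
  by rewrite -fmap_id phi_natural.
rewrite /gphi tensm_addl tensm_addr !addmA.
rewrite -[X in (X + _)%hom]addmA EL -[X in _ = (X + _ + _)%hom]addmA ER.
rewrite !addmA -!fmap_add phi_assoc !fmap_add.
by rewrite -!addmA [(_ + (phi G _ _ + _))%hom]addmA phi_assoc !addmA.
Qed.

Fact comp_phi_runit (x : C) :
  (fmap G (fmap F (runit x)) + gphi x unito + \0_(G (F x)) ⊠ gphi0
   = runit (G (F x)))%hom.
Proof.
have ER : (phi G (F x) (F unito) + \0_(G (F x)) ⊠ fmap G (phi0 F)
    = fmap G (\0_(F x) ⊠ phi0 F) + phi G (F x) unito)%hom.
  by rewrite -fmap_id phi_natural.
rewrite /gphi /gphi0 tensm_addr !addmA -[X in (X + _)%hom]addmA ER.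
by rewrite !addmA -!fmap_add phi_runit phi_runit.
Qed.

Fact comp_phi_comm (x y : C) :
  (gphi y x + comm (G (F x)) (G (F y))
   = fmap G (fmap F (comm x y)) + gphi x y)%hom.
Proof.
by rewrite /gphi -addmA phi_comm !addmA -!fmap_add phi_comm.
Qed.

Definition smfunctor_comp : smfunctor C E :=
  @SMFunctor C E (functor_comp G F) gphi gphi0
    comp_phi_natural comp_phi_assoc comp_phi_runit comp_phi_comm.
End SMFunctorComp.

Definition symmetric_iso (C D : ssmag) (F F' : smfunctor C D) : Prop :=
  exists theta : forall x : C, hom (F x) (F' x),
  [/\ forall (x y : C) (u : hom x y),
        (theta y + fmap F u = fmap F' u + theta x)%hom,
      forall x y : C,
        (theta (x ⊗ y) + phi F x y = phi F' x y + theta x ⊠ theta y)%hom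
    & (theta unito + phi0 F = phi0 F')%hom].

Definition sm_equivalence (C D : ssmag) (F : smfunctor C D) : Prop :=
  exists F' : smfunctor D C,
    symmetric_iso (smfunctor_comp F' F) (smfunctor_id C) /\
    symmetric_iso (smfunctor_comp F F') (smfunctor_id D).

Definition sm_equivalent (C D : ssmag) : Prop :=
  exists F : smfunctor C D, sm_equivalence F.

Section TheGroupoidS.
Variables (M : comMonoidType) (A : hfunctor M) (h : cocycle3 A).
Local Open Scope group_scope.
Local Open Scope ring_scope.

(* An arrow a -> b exists only if a = b, and is then an element of A a. *)
Record Shom (a b : M) := SHom { Sval : A a; Seq : a = b }.

Lemma Shom_inj a b (u v : Shom a b) : Sval u = Sval v -> u = v.
Proof.
by case: u v => [u p] [v q] /= e; rewrite e (eq_irrelevance p q).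
Qed.

Definition Sid a : Shom a a := SHom 0 erefl.

Definition Sadd a b c (v : Shom b c) (u : Shom a b) : Shom a c :=
  SHom (cast (esym (Seq u)) (Sval v) + Sval u) (etrans (Seq u) (Seq v)).

Definition Sopp a b (u : Shom a b) : Shom b a :=
  SHom (- cast (Seq u) (Sval u)) (esym (Seq u)).

Fact SaddA a b c d (w : Shom c d) (v : Shom b c) (u : Shom a b) :
  Sadd w (Sadd v u) = Sadd (Sadd w v) u.
Proof.
apply: Shom_inj => /=; rewrite castD cast_cast addrA.
by congr (_ + _ + _); apply: cast_irr.
Qed.

Fact Sadd0 a b (u : Shom a b) : Sadd (Sid b) u = u.
Proof. by apply: Shom_inj => /=; rewrite cast0 add0r. Qed.

Fact S0add a b (u : Shom a b) : Sadd u (Sid a) = u.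
Proof. by apply: Shom_inj => /=; rewrite addr0. Qed.

Fact SaddN a b (u : Shom a b) : Sadd (Sopp u) u = Sid a.
Proof. by apply: Shom_inj => /=; rewrite castN cast_cast cast_id addNr. Qed.

Fact SNadd a b (u : Shom a b) : Sadd u (Sopp u) = Sid b.
Proof.
apply: Shom_inj => /=; rewrite (cast_irr _ (Seq u)) ?subrr //.
Qed.

Definition Sgpd : groupoid := Groupoid SaddA Sadd0 S0add SaddN SNadd.

Definition Stensm a a' b b' (u : Shom a a') (v : Shom b b') :
    Shom (a * b)%g (a' * b')%g :=
  SHom (hmap b (Sval u) + cast (mulgC b a) (hmap a (Sval v)))
    (congr2 mul (Seq u) (Seq v)).

Definition Sdata : smdata := @SMData Sgpd (fun a b => a * b)%g Stensm 1%g
  (fun a b c => SHom (h a b c) (esym (mulgA a b c)))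
  (fun a => SHom 0 (mulg1 a))
  (fun a b => SHom 0 (mulgC a b)).

Fact S_abelian : abelian_groupoid Sdata.
Proof.
move=> a u v; apply: Shom_inj => /=.
by rewrite !cast_id addrC.
Qed.

Lemma cocycle3_pentagon a b c d :
  cast (mulgA (a * b)%g c d) (h a b (c * d)%g) + h (a * b)%g c d
  = cast (mulg_rot4 a b c d) (hmap a (h b c d))
    + cast (mulgA4 a b c d) (h a (b * c)%g d) + hmap d (h a b c).
Proof.
have e5 (V : zmodType) (x y z t u : V) :
    x - y + z - t + u = 0 -> t + y = x + z + u.
  move=> e; rewrite -[LHS]add0r -e addrA [in LHS](addrAC _ (- t) u) subrK.
  by rewrite (addrAC _ u y) (addrAC _ z y) subrK.
exact/e5/cocycle3P.
Qed.

Lemma cochain3_hexagon a b c (e : (b * a * c = a * b * c)%g) :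
  cast e (h b a c) = cast (mulg_rot a b c) (h b c a) + h a b c.
Proof.
have /eqP := cochain3_rev h b a c; rewrite addrC addr_eq0 => /eqP ->.
have /eqP := cochain3_rot h a b c; rewrite addrC addr_eq0 => /eqP E.
by rewrite castN cast_cast (cast_irr _ (mulg_rotl a b c)) E opprK addrC.
Qed.

Lemma cochain3_mid a b : h a 1%g b = 0.
Proof.
have := cochain3_rot h a 1%g b; rewrite cochain3_1 cast0 addr0.
have := cochain3_rev h a b 1%g; rewrite cochain3_1 addr0 => /eqP.
rewrite -(cast0 A (mulg_rev a b 1%g)) (inj_eq (@cast_inj _ _ _ _ _)) => /eqP ->.
by rewrite cast0 addr0.
Qed.

Fact S_strictly_symmetric : strictly_symmetric Sdata.
Proof.
split.
- by move=> a b; apply: Shom_inj => /=; rewrite !raddf0 addr0.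
- move=> a a' a'' b b' b'' [u' p'] [u p] [v' q'] [v q] /=.
  case: a'' / p'; case: a' / p u' => u'; case: b'' / q'; case: b' / q v' => v'.
  by apply: Shom_inj => /=; rewrite !cast_id !(raddfD (hmap _)) /= castD addrACA.
- move=> a a' b b' c c' [u p] [v q] [w r] /=.
  case: a' / p; case: b' / q; case: c' / r; apply: Shom_inj => /=.
  rewrite cast_id !(raddfD (hmap _)) /= !castD [RHS]addrC -!addrA.
  rewrite !hmap_cast !cast_cast; congr (_ + (_ + (_ + _))).
  + by rewrite hmapM; apply: cast_irr.
  + exact: hmap_comm.
  + by apply/esym/hmap_mul/mulgC.
- move=> a a' [u p]; case: a' / p; apply: Shom_inj => /=.
  rewrite !raddf0 ?cast0 !addr0 !add0r -[in RHS](hmap1 u) cast_cast.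
  by rewrite cast_id.
- move=> a a' b b' [u p] [v q]; case: a' / p; case: b' / q.
  apply: Shom_inj => /=; rewrite cast0 add0r addr0 castD cast_cast cast_id addrC.
  by congr (_ + _); apply: cast_irr.
- move=> a b c d; apply: Shom_inj => /=.
  rewrite !raddf0 ?cast0 !add0r addr0 !castD !cast_cast.
  rewrite (cast_irr _ (mulgA (a * b)%g c d)) cocycle3_pentagon.
  by congr (_ + _ + _); apply: cast_irr.
- move=> a b c; apply: Shom_inj => /=.
  rewrite !(raddf0, cast0, add0r, addr0) !cast_cast cochain3_hexagon.
  by congr (_ + _); apply: cast_irr.
- move=> a b; apply: Shom_inj => /=.
  by rewrite cochain3_mid !(raddf0, cast0, addr0).
- by move=> a b; apply: Shom_inj => /=; rewrite cast0 addr0.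
- by move=> a; apply: Shom_inj.
Qed.

Definition calS : ssmag := SSMAG S_abelian S_strictly_symmetric.
End TheGroupoidS.

(* Main.v *)
Require Import Defs.
From HB Require Import structures.
From mathcomp Require Import all_boot ssralg.
From mathcomp Require Import boolp.
Set Implicit Arguments.
Unset Strict Implicit.
Unset Printing Implicit Defensive.

Import GRing.Theory.
Local Open Scope quotient_scope.
Local Open Scope hom_scope.

(** A strictly symmetric monoidal abelian groupoid [C] is recovered from a
skeleton. The isomorphism classes of objects form a commutative monoid [M]; choose
representatives [obj a] and isomorphisms [f a b] from [obj a ⊗ obj b] to
[obj (a * b)]. The decisive point is that the [f a b] can be chosen so that the
symmetry and the unit constraint become identities
([exists_symmetric_unital]): fix [f] on one order of each pair and deduce the
other order from the symmetry, which is consistent because the symmetry is an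
involution and is the identity on [x ⊗ x]. The unit constraint imposes [f] where
one of the factors is the unit.

The coefficients are then the groups [Aut (obj a)], the operator [b_*] being
tensoring with [obj b] followed by conjugation with [f a b]. Since the
automorphism groups are abelian, conjugation by an arrow depends only on its
source and target ([conjm_indep]), and this makes [b_*] functorial. The cocycle
[h] is the associator read through [f]. The pentagon, the hexagon and the triangle
of [C] reflect to the skeleton ([reflect_pentagon], [reflect_hexagon],
[reflect_triangle]), where the symmetry and the unit are identities; they say that
[h] is closed, that [h b a c = h b c a + h a b c] and that [h a 1 b = 0], and
these imply the symmetry and normalization conditions on cochains
([coherent_cocycle3]). The inclusion of the skeleton is a symmetric monoidal
functor with structure maps [f], and it is fully faithful and essentially
surjective.

Such a functor is a symmetric monoidal equivalence
([fully_faithful_sm_equivalence]). This settles the first part, and also one half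
of the classification: if [h] and the transported [h'] differ by the coboundary of
[g], then [i] on objects, [psi] on automorphisms and [g] as structure maps define a
symmetric monoidal functor ([cohomologous_smfunctor]) which is bijective on objects
and on arrows. Conversely, between groupoids where arrows only join equal
objects, a symmetric monoidal functor consists of a multiplicative map, a natural
family of homomorphisms and a symmetric cochain, the condition on associators
saying that the cocycles differ by the coboundary of that cochain
([induced_cochain2P]). The cochain is normalized by absorbing the unit component of
the functor into it, which leaves its coboundary unchanged. *)

(** * Composites and conjugation in groupoids *)

Section GroupoidTheory.
Variable G : groupoid.
Implicit Types x y z t : G.

Lemma addmK x y z (v : hom y z) (u : hom x y) : v + u + - u = v.
Proof. by rewrite -addmA addmN addm0. Qed.

Lemma addmNK x y z (v : hom y z) (u : hom y x) : v + - u + u = v.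
Proof. by rewrite -addmA addNm addm0. Qed.

Lemma addKm x y z (v : hom y z) (u : hom x y) : - v + (v + u) = u.
Proof. by rewrite addmA addNm add0m. Qed.

Lemma addmI x y z (v : hom y z) : forall u u' : hom x y, v + u = v + u' -> u = u'.
Proof. by move=> u u' e; rewrite -(addKm v u) e addKm. Qed.

Lemma addIm x y z (u : hom x y) : forall v v' : hom y z, v + u = v' + u -> v = v'.
Proof. by move=> v v' e; rewrite -(addmK v u) e addmK. Qed.

Lemma oppmD x y z (v : hom y z) (u : hom x y) : - (v + u) = - u + - v.
Proof. by apply: (@addIm _ _ _ (v + u)); rewrite addNm addmA addmNK addNm. Qed.

(** Compositions are put in right-nested form during the diagram chases, and
these lemmas apply an equation between two composites in front of a tail. *)
Lemma addm_tail x y y' z t (v : hom y z) (u : hom x y) (v' : hom y' z)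
    (u' : hom x y') (w : hom t x) :
  v + u = v' + u' -> v + (u + w) = v' + (u' + w).
Proof. by rewrite !addmA => ->. Qed.

Lemma addm_tail3 x y1 y2 z1 z2 t s (a : hom z1 t) (b : hom y1 z1)
    (c : hom x y1) (a' : hom z2 t) (b' : hom y2 z2) (c' : hom x y2)
    (w : hom s x) :
  a + (b + c) = a' + (b' + c') ->
  a + (b + (c + w)) = a' + (b' + (c' + w)).
Proof. by rewrite !addmA => ->. Qed.

(** Transport of automorphisms along an arrow; the coefficient functor of a
groupoid and all comparisons of its values are made of such conjugations. *)
Definition conjm x y (f : hom x y) (u : hom x x) : hom y y := f + u + - f.

Lemma conjm0 x y (f : hom x y) : conjm f \0_x = \0_y.
Proof. by rewrite /conjm addm0 addmN. Qed.

Lemma conjmD x y (f : hom x y) u v : conjm f (u + v) = conjm f u + conjm f v.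
Proof. by rewrite /conjm !addmA addmNK. Qed.

Lemma conjm_comp x y z (f : hom y z) (g : hom x y) u :
  conjm f (conjm g u) = conjm (f + g) u.
Proof. by rewrite /conjm oppmD !addmA. Qed.

Lemma conjm_swap x y (f : hom x y) u v : v + f = f + u -> conjm f u = v.
Proof. by rewrite /conjm => <-; rewrite addmK. Qed.

Lemma conjmP x y (f : hom x y) u : conjm f u + f = f + u.
Proof. exact: addmNK. Qed.

(** Changing [f] composes the conjugation with an inner automorphism, which is
trivial when automorphism groups are abelian. *)
Lemma conjm_indep : abelian_groupoid G ->
  forall x y (f g : hom x y) u, conjm f u = conjm g u.
Proof.
move=> abG x y f g u; apply: conjm_swap; apply: (@addmI _ _ _ (- g)).
by rewrite /conjm -!addmA addKm [RHS]addmA [RHS]abG.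
Qed.
End GroupoidTheory.

Section TensorTheory.
Variable C : ssmag.
Implicit Types x y z : C.
Let axC := ssmag_axioms C.

Lemma tensmD x x' x'' y y' y'' (u' : hom x' x'') (u : hom x x')
    (v' : hom y' y'') (v : hom y y') :
  (u' ⊠ v') + (u ⊠ v) = ((u' + u) ⊠ (v' + v) : hom (x ⊗ y : C) _).
Proof. by rewrite (tensm_add axC). Qed.

Lemma tensm_split x x' y y' (u : hom x x') (v : hom y y') :
  u ⊠ \0_y' + \0_x ⊠ v = (u ⊠ v : hom (x ⊗ y : C) _).
Proof. by rewrite tensmD add0m addm0. Qed.

Lemma tensm_splitC x x' y y' (u : hom x x') (v : hom y y') :
  \0_x' ⊠ v + u ⊠ \0_y = (u ⊠ v : hom (x ⊗ y : C) _).
Proof. by rewrite tensmD add0m addm0. Qed.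

Lemma tensm0 x y : \0_x ⊠ \0_y = \0_(x ⊗ y : C).
Proof. exact: (tensm_id axC). Qed.

Lemma tensmN x x' y y' (u : hom x x') (v : hom y y') :
  (- u) ⊠ (- v) = - (u ⊠ v : hom (x ⊗ y : C) _).
Proof.
by apply: (@addIm _ _ _ _ (u ⊠ v)); rewrite tensmD !addNm tensm0.
Qed.

Lemma conjm_tensm x x' y y' (f : hom x x') (g : hom y y')
    (u : hom x x) (v : hom y y) :
  conjm f u ⊠ conjm g v = conjm (f ⊠ g : hom (x ⊗ y : C) _) (u ⊠ v).
Proof. by rewrite /conjm -tensmN !tensmD. Qed.
End TensorTheory.

(** * Fully faithful, essentially surjective symmetric monoidal functors *)

Lemma phi_assocr (C D : ssmag) (F : smfunctor C D) (x y z : C) :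
  fmap F (assoc x y z) + (phi F (x ⊗ y) z + phi F x y ⊠ \0_(F z))
  = phi F x (y ⊗ z) + (\0_(F x) ⊠ phi F y z + assoc (F x) (F y) (F z)).
Proof. by rewrite !addmA phi_assoc. Qed.

(** A quasi-inverse is determined by preimages [ob y] of the objects, with arrows
[eps y] from their images, and by inverses of the maps on arrows: its arrows and
structure maps are the only ones that make [eps] a symmetric isomorphism to the
identity (see [eps_nat], [eps_phi] and [eps_phi0]). Each axiom of the
quasi-inverse is then checked after applying the faithful functor [F], composing
with the invertible [eps] on one side and with structure maps of [F] on the
other, where it becomes the corresponding naturality condition in the target. *)
Section FullyFaithful.
Variables (C D : ssmag) (F : smfunctor C D).
Variables (ob : D -> C) (eps : forall y, hom (F (ob y)) y).
Variable lift : forall x y : C, hom (F x) (F y) -> hom x y.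
Hypothesis fmapK : forall x y, cancel (@fmap _ _ F x y) (@lift x y).
Hypothesis liftK : forall x y, cancel (@lift x y) (@fmap _ _ F x y).
Let axD := ssmag_axioms D.

Let fmap_inj x y : injective (@fmap _ _ F x y).
Proof. exact: can_inj (@fmapK x y). Qed.

Let inv_map x y (v : hom x y) : hom (ob x) (ob y) :=
  lift (- eps y + (v + eps x)).
Let inv_phi x y : hom (ob x ⊗ ob y) (ob (x ⊗ y)) :=
  lift (- eps (x ⊗ y) + ((eps x ⊠ eps y) + - phi F (ob x) (ob y))).
Let inv_phi0 : hom unito (ob unito) := lift (- eps unito + - phi0 F).

Let eps_nat x y (v : hom x y) : eps y + fmap F (inv_map v) = v + eps x.
Proof. by rewrite liftK !addmA addmN add0m. Qed.

Let eps_phi x y :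
  eps (x ⊗ y) + (fmap F (inv_phi x y) + phi F (ob x) (ob y)) = eps x ⊠ eps y.
Proof. by rewrite liftK -!addmA addNm addm0 !addmA addmN add0m. Qed.

Let eps_phi0 : eps unito + (fmap F inv_phi0 + phi0 F) = \0_unito.
Proof. by rewrite liftK -!addmA addNm addm0 addmN. Qed.

Let inv_map_id x : inv_map \0_x = \0_(ob x).
Proof. by rewrite /inv_map add0m addNm -fmap_id fmapK. Qed.

Let inv_map_add x y z (v : hom y z) (u : hom x y) :
  inv_map (v + u) = inv_map v + inv_map u.
Proof.
apply/fmap_inj/(@addmI _ _ _ _ (eps z)).
by rewrite fmap_add eps_nat (addm_tail _ (eps_nat v)) eps_nat addmA.
Qed.

Let inv_functor : functor D C := Functor inv_map_id inv_map_add.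

Let inv_phi_natural x x' y y' (u : hom x x') (v : hom y y') :
  inv_phi x' y' + inv_map u ⊠ inv_map v = inv_map (u ⊠ v) + inv_phi x y.
Proof.
apply/fmap_inj/(@addmI _ _ _ _ (eps _))/(@addIm _ _ _ _ (phi F (ob x) (ob y))).
rewrite /= !fmap_add -!addmA (addm_tail _ (eps_nat _)) eps_phi.
by rewrite -phi_natural !addmA -(addmA (eps _)) eps_phi !tensmD !eps_nat.
Qed.

Let inv_phi_assoc x y z :
  inv_map (assoc x y z) + inv_phi (x ⊗ y) z + inv_phi x y ⊠ \0_(ob z)
  = inv_phi x (y ⊗ z) + \0_(ob x) ⊠ inv_phi y z + assoc (ob x) (ob y) (ob z).
Proof.
apply/fmap_inj/(@addmI _ _ _ _ (eps _)).
apply/(@addIm _ _ _ _ (phi F (ob x ⊗ ob y) (ob z)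
  + (phi F (ob x) (ob y) ⊠ \0_(F (ob z))))).
rewrite /= !fmap_add -!addmA (addm_tail _ (eps_nat _)).
rewrite (addm_tail _ (esym (phi_natural _ _ _))) fmap_id tensmD add0m.
rewrite (addmA (fmap F (inv_phi _ _))) (addmA (eps _)) eps_phi tensmD addm0.
rewrite eps_phi (assoc_natural axD) phi_assocr.
rewrite (addm_tail _ (esym (phi_natural _ _ _))) fmap_id.
rewrite (addmA (_ ⊠ _)) tensmD add0m (addmA (fmap F _)) (addmA (eps _)) eps_phi.
by rewrite [RHS]addmA tensmD addm0 eps_phi.
Qed.

Let inv_phi_runit x :
  inv_map (runit x) + inv_phi x unito + \0_(ob x) ⊠ inv_phi0 = runit (ob x).
Proof.
apply/fmap_inj/(@addmI _ _ _ _ (eps _)).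
apply/(@addIm _ _ _ _ (phi F (ob x) unito + (\0_(F (ob x)) ⊠ phi0 F))).
rewrite /= !fmap_add -!addmA (addm_tail _ (eps_nat _)).
rewrite (addm_tail _ (esym (phi_natural _ _ _))) fmap_id tensmD add0m.
rewrite (addmA (fmap F (inv_phi _ _))) (addmA (eps _)) eps_phi tensmD addm0.
rewrite eps_phi0 (addmA (fmap F _)) phi_runit.
exact: (runit_natural axD).
Qed.

Let inv_phi_comm x y :
  inv_phi y x + comm (ob x) (ob y) = inv_map (comm x y) + inv_phi x y.
Proof.
apply/fmap_inj/(@addmI _ _ _ _ (eps _))/(@addIm _ _ _ _ (phi F (ob x) (ob y))).
rewrite /= !fmap_add -!addmA (addm_tail _ (eps_nat _)) eps_phi -phi_comm.
by rewrite (addmA (fmap F _)) (addmA (eps _)) eps_phi (comm_natural axD).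
Qed.

Let inv_smfunctor : smfunctor D C :=
  @SMFunctor D C inv_functor inv_phi inv_phi0
    inv_phi_natural inv_phi_assoc inv_phi_runit inv_phi_comm.

Lemma fully_faithful_sm_equivalence : sm_equivalence F.
Proof.
exists inv_smfunctor; split.
  (* The other isomorphism is the one that [F] maps to [eps]. *)
  exists (fun x => lift (eps (F x))); split=> [x y u|x y|].
  - by apply/fmap_inj; rewrite /= !fmap_add !(liftK (eps _)) eps_nat.
  - apply/fmap_inj/(@addIm _ _ _ _ (phi F _ _)).
    rewrite /= add0m !fmap_add -!addmA (liftK (eps _)).
    rewrite (addm_tail _ (eps_nat _)) eps_phi.
    by rewrite -phi_natural !(liftK (eps _)).
  apply/fmap_inj/(@addIm _ _ _ _ (phi0 F)).
  rewrite /= fmap_id add0m !fmap_add -!addmA (liftK (eps _)).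
  by rewrite (addm_tail _ (eps_nat _)) eps_phi0 addm0.
exists eps; split=> [x y u|x y|] /=.
- exact: eps_nat.
- by rewrite add0m eps_phi.
exact: eps_phi0.
Qed.
End FullyFaithful.


(** * Coherence conditions reflected along faithful functors *)

(** The coherence conditions are equations between composites of invertible
arrows. Applying [F] to the two sides and precomposing with structure maps [f]
moves the constraints of [D] to those of [C], where the condition holds; as [F]
is faithful and the [f] are invertible, it holds in [D]. *)
Section ReflectCoherence.
Variables (D : smdata) (C : ssmag) (F : functor D C).
Variables (f : forall x y : D, hom (F x ⊗ F y) (F (x ⊗ y))).
Variables (f0 : hom unito (F unito)).
Hypothesis fmap_inj : forall x y : D, injective (@fmap _ _ F x y).
Hypothesis f_natural : forall (x x' y y' : D) (u : hom x x') (v : hom y y'),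
  f x' y' + fmap F u ⊠ fmap F v = fmap F (u ⊠ v) + f x y.
Hypothesis f_assoc : forall x y z : D,
  fmap F (assoc x y z) + (f (x ⊗ y) z + f x y ⊠ \0_(F z))
  = f x (y ⊗ z) + (\0_(F x) ⊠ f y z + assoc (F x) (F y) (F z)).
Hypothesis f_runit : forall x : D,
  fmap F (runit x) + (f x unito + \0_(F x) ⊠ f0) = runit (F x).
Hypothesis f_comm : forall x y : D,
  f y x + comm (F x) (F y) = fmap F (comm x y) + f x y.
Let axC := ssmag_axioms C.

Let f_natl (x x' y : D) (u : hom x x') :
  fmap F (u ⊠ \0_y) + f x y = f x' y + fmap F u ⊠ \0_(F y).
Proof. by rewrite -f_natural fmap_id. Qed.

Let f_natr (x y y' : D) (v : hom y y') :
  fmap F (\0_x ⊠ v) + f x y = f x y' + \0_(F x) ⊠ fmap F v.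
Proof. by rewrite -f_natural fmap_id. Qed.

Lemma reflect_pentagon (x y z t : D) :
  assoc x y (z ⊗ t) + assoc (x ⊗ y) z t
  = \0_x ⊠ assoc y z t + assoc x (y ⊗ z) t + assoc x y z ⊠ \0_t.
Proof.
apply/fmap_inj/(@addIm _ _ _ _ (f (x ⊗ y ⊗ z) t + (f (x ⊗ y) z ⊠ \0_(F t)
  + (f x y ⊠ \0_(F z)) ⊠ \0_(F t)))).
rewrite !fmap_add -!addmA; transitivity (f x (y ⊗ (z ⊗ t))
  + (\0_(F x) ⊠ (f y (z ⊗ t) + \0_(F y) ⊠ f z t)
  + (assoc (F x) (F y) (F z ⊗ F t) + assoc (F x ⊗ F y) (F z) (F t)))).
  rewrite (addm_tail3 _ (f_assoc _ _ _)) (assoc_natural axC) tensm0.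
  rewrite (addmA (\0_(F (x ⊗ y)) ⊠ _)) tensm_splitC -tensm_split.
  rewrite -!addmA (addm_tail3 _ (f_assoc _ _ _)).
  rewrite -(tensm0 (F x) (F y)) (addmA (assoc _ _ _)) (assoc_natural axC).
  by rewrite tensm_addr -!addmA.
rewrite (addm_tail _ (f_natl _ _)) (addmA (_ ⊠ _) (_ ⊠ _)) !tensmD !addm0.
rewrite -addmA f_assoc !tensm_addl (addm_tail3 _ (f_assoc _ _ _)).
rewrite (addm_tail _ (assoc_natural axC _ _ _)) (addm_tail _ (f_natr _ _)).
do 2!rewrite [in RHS](addmA (\0_(F x) ⊠ _)) -[in RHS]tensm_addr.
rewrite -[in RHS](addmA (fmap F _)) f_assoc !tensm_addr -!addmA; do 3!congr (_ + _).
by rewrite (pentagon axC) !addmA.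
Qed.

Lemma reflect_hexagon (x y z : D) :
  \0_y ⊠ comm x z + assoc y x z + comm x y ⊠ \0_z
  = assoc y z x + comm x (y ⊗ z) + assoc x y z.
Proof.
apply/fmap_inj/(@addIm _ _ _ _ (f (x ⊗ y) z + f x y ⊠ \0_(F z))).
rewrite !fmap_add -!addmA; transitivity (f y (z ⊗ x) + (\0_(F y) ⊠ f z x
  + (\0_(F y) ⊠ comm (F x) (F z) + (assoc (F y) (F x) (F z)
  + comm (F x) (F y) ⊠ \0_(F z))))).
  rewrite (addm_tail _ (f_natl _ _)) -tensm_addl -f_comm tensm_addl.
  rewrite (addm_tail3 _ (f_assoc _ _ _)) (addm_tail _ (f_natr _ _)).
  by rewrite (addmA (\0_(F y) ⊠ _)) -tensm_addr -f_comm tensm_addr -!addmA.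
rewrite f_assoc (addm_tail _ (esym (f_comm _ _))).
rewrite (addm_tail _ (comm_natural axC _ _)) (addm_tail3 _ (f_assoc _ _ _)).
by do 2!congr (_ + _); rewrite !addmA (hexagon axC).
Qed.

Lemma reflect_triangle (x y : D) :
  \0_x ⊠ runit y + \0_x ⊠ comm unito y + assoc x unito y = runit x ⊠ \0_y.
Proof.
apply/fmap_inj/(@addIm _ _ _ _ (f (x ⊗ unito) y + (f x unito ⊠ \0_(F y)
  + (\0_(F x) ⊠ f0) ⊠ \0_(F y)))).
rewrite !fmap_add -!addmA; transitivity (f x y + runit (F x) ⊠ \0_(F y)).
  rewrite (addm_tail3 _ (f_assoc _ _ _)) (assoc_natural axC).
  rewrite (addm_tail _ (f_natr _ _)) (addm_tail _ (f_natr _ _)).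
  do 2!rewrite (addmA (\0_(F x) ⊠ _)) -tensm_addr.
  rewrite (addmA (\0_(F x) ⊠ _)) -tensm_addr -(triangle axC) -tensm_addr.
  rewrite -!(addmA (fmap _ _)) (addm_tail _ (esym (f_comm _ _))).
  by rewrite (comm_natural axC) !addmA -(addmA (fmap _ _)) f_runit.
rewrite (addm_tail _ (f_natl _ _)); congr (_ + _).
by rewrite -!tensm_addl f_runit.
Qed.
End ReflectCoherence.


(** * Cohomologous cocycles give equivalent groupoids *)

(** A cochain identity, with [X] and [H] the values of the two cocycles, is the
square that a symmetric monoidal functor has to satisfy for associativity. The
primed variables stand for the same elements as the unprimed ones, reached by
transports along other proofs of the same equality. *)
Lemma square_of_coboundary (V : zmodType) (X H E B D C H' E' B' D' C' : V) :
  (X - H = E - B + D - C -> B' = B -> C' = C -> D' = D -> E' = E -> H' = H ->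
  X + B' + C' = D' + E' + H')%R.
Proof.
move=> e -> -> -> -> ->; rewrite -(GRing.subrK H X) e.
rewrite (addrAC _ H B) (addrAC _ H C) (addrAC _ (- C)%R B) subrK.
by rewrite (addrAC _ D B) subrK (addrC E).
Qed.

(** The functor is [i] on objects and [psi] on automorphisms, and its structure
maps are the values of the cochain [g]: symmetry and normalization of [g] are the
compatibility with the symmetry and the unit, and the coboundary equation is the
compatibility with the associativity. *)
Section FunctorOfCohomologous.
Variables (M M' : comMonoidType) (A : hfunctor M) (A' : hfunctor M').
Variables (h : cocycle3 A) (h' : cocycle3 A') (i : UMagmaMorphism.type M M').
Variables (psi : hiso A (pullback i A')) (g : cochain2 A).
Hypothesis i_bij : bijective i.
Local Open Scope ring_scope.
Hypothesis hg : forall a b c, h a b c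
  - hiso_inv psi (cast (esym (gmulfM3 i a b c)) (h' (i a) (i b) (i c)))
  = partial2 g a b c.

Let S_map (a b : M) (u : Shom A a b) : Shom A' (i a) (i b) :=
  @SHom M' A' (i a) (i b) (psi a (Sval u)) (congr1 i (Seq u)).

Let S_map_id (a : M) : S_map (Sid A a) = Sid A' (i a).
Proof. by apply: Shom_inj; rewrite /= raddf0. Qed.

Let S_map_add (a b c : M) (v : Shom A b c) (u : Shom A a b) :
  S_map (Sadd v u) = Sadd (S_map v) (S_map u).
Proof.
apply: Shom_inj => /=; rewrite raddfD hiso_cast /= cast_pull.
by congr (_ + _); apply: cast_irr.
Qed.

Let S_functor : functor (Sgpd A) (Sgpd A') :=
  @Functor (Sgpd A) (Sgpd A') (i : M -> M') S_map S_map_id S_map_add.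

Let S_phi (a b : M) : Shom A' (i a * i b)%g (i (a * b)%g) :=
  @SHom M' A' (i a * i b)%g (i (a * b)%g)
    (cast (gmulfM a b) (psi (a * b)%g (g a b) : A' _)) (esym (gmulfM a b)).

Let S_phi0 : Shom A' 1%g (i 1%g) := @SHom M' A' 1%g (i 1%g) 0 (esym gmulf1).

Definition cohomologous_smfunctor : smfunctor (calS h) (calS h').
Proof.
apply: (@SMFunctor (calS h) (calS h') S_functor S_phi S_phi0).
- move=> a a' b b' [u p] [v q].
  case: a' / p; case: b' / q; apply: Shom_inj => /=.
  rewrite cast_id addrC; congr (_ + _).
  rewrite raddfD hiso_cast !hiso_natural /= castD !cast_cast.
  rewrite cast_pull !cast_cast cast_id; congr (_ + _).
  exact: cast_irr.
- move=> a b c; apply: Shom_inj => /=.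
  rewrite !raddf0 ?cast0 ?add0r ?addr0.
  have := congr1 (psi _) (hg a b c); rewrite raddfB /= hisoVK.
  rewrite /partial2 !(raddfD (psi _), raddfN (psi _)) /= !hiso_cast !hiso_natural.
  rewrite !hmap_pull !cast_pull => E.
  apply: (@cast_inj _ A' _ _ (esym (gmulfM3 i a b c))).
  rewrite !(castD, hmap_cast, cast_cast) cast_id.
  apply: square_of_coboundary E _ _ _ _ _; rewrite ?cast_cast.
  + exact: cast_id.
  + exact: cast_irr.
  + exact: cast_irr.
  + exact: cast_irr.
  + exact: cast_irr.
- move=> a; apply: Shom_inj => /=.
  by rewrite cochain2_1 !(raddf0, cast0, addr0).
- move=> a b; apply: Shom_inj => /=.
  rewrite !(raddf0, cast0, addr0, add0r).
  rewrite -(cochain2_sym g a b) hiso_cast cast_pull !cast_cast.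
  exact: cast_irr.
Defined.

Lemma cohomologous_sm_equivalence : sm_equivalence cohomologous_smfunctor.
Proof.
case: i_bij => j iK jK.
apply: (@fully_faithful_sm_equivalence _ _ cohomologous_smfunctor j
  (fun y => @SHom M' A' (i (j y)) y 0 (jK y))
  (fun x y v => @SHom M A x y (hiso_inv psi (Sval v)) (can_inj iK (Seq v)))).
- by move=> x y u; apply: Shom_inj; rewrite /= hisoK.
- by move=> x y u; apply: Shom_inj; rewrite /= hisoVK.
Qed.
End FunctorOfCohomologous.


(** * Equivalent groupoids have cohomologous cocycles *)

Lemma retract_faithful (C D : ssmag) (F : smfunctor C D) (G : smfunctor D C) :
  symmetric_iso (smfunctor_comp G F) (smfunctor_id C) ->
  forall x y, injective (@fmap _ _ F x y).
Proof.
case=> theta [nat _ _] x y u v e; apply: (@addIm _ _ _ _ (theta x)).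
by have /= <- := nat _ _ u; rewrite e; exact: nat.
Qed.

(** The inverse of [F] on arrows is the quasi-inverse conjugated by the
isomorphism to the identity. It is a left inverse by naturality, hence a right
inverse because the quasi-inverse is faithful in its turn. *)
Lemma sm_equivalence_lift (C D : ssmag) (F : smfunctor C D) :
  sm_equivalence F ->
  exists lift : forall x y, hom (F x) (F y) -> hom x y,
    (forall x y, cancel (@fmap _ _ F x y) (@lift x y)) /\
    (forall x y, cancel (@lift x y) (@fmap _ _ F x y)).
Proof.
case=> G [] [theta [nat _ _]] /retract_faithful Ginj.
have K x y : cancel (@fmap _ _ F x y)
    (fun v => theta y + (fmap G v + - theta x)).
  by move=> u; rewrite addmA; have /= -> := nat _ _ u; rewrite addmK.
exists (fun x y v => theta y + (fmap G v + - theta x)); split=> // x y v.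
apply: Ginj; apply: (@addIm _ _ _ _ (- theta x)).
by apply: (@addmI _ _ _ _ (theta y)); rewrite K.
Qed.

(** Converse of [square_of_coboundary], for a cochain whose four terms have each
been modified by the same element [N], which cancels. *)
Lemma coboundary_of_square (V : zmodType) (X0 X B C D E H N B' C' D' E' : V) :
  (X0 + B + C = D + E + H -> X0 = X ->
   E' = E + N -> B' = B + N -> D' = D + N -> C' = C + N ->
  X - H = E' - B' + D' - C')%R.
Proof.
move=> e eX -> -> -> ->; have e1 (x y : V) : ((x + N) - (y + N) = x - y)%R.
  by rewrite opprD addrACA subrr addr0.
rewrite e1 -addrA e1 -[X]eX; move/(canRL (addrK _))/(canRL (addrK _)): e => ->.
rewrite (addrAC _ _ (- H)%R) (addrAC _ _ (- H)%R) addrK.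
by rewrite [RHS]addrACA (addrC E) (addrC (- B)%R) addrA.
Qed.

(** As there are arrows only between equal objects, the structure maps of [F]
show that it is multiplicative on objects; on automorphisms it gives the natural
isomorphism of coefficients, and the values of its structure maps give a
symmetric cochain. *)
Section CohomologousOfFunctor.
Variables (M M' : comMonoidType) (A : hfunctor M) (A' : hfunctor M').
Variables (h : cocycle3 A) (h' : cocycle3 A').
Variable F : smfunctor (calS h) (calS h').
Variable lift : forall x y : calS h, hom (F x) (F y) -> hom x y.
Hypothesis fmapK : forall x y, cancel (@fmap _ _ F x y) (@lift x y).
Hypothesis liftK : forall x y, cancel (@lift x y) (@fmap _ _ F x y).
Local Open Scope group_scope.
Local Open Scope ring_scope.

Definition induced_obj (a : M) : M' := F a.

Fact induced_objM : {morph induced_obj : a b / (a * b)%g}.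
Proof. by move=> a b; exact: esym (Seq (phi F a b)). Qed.

Fact induced_obj1 : induced_obj 1%g = 1%g.
Proof. exact: esym (Seq (phi0 F)). Qed.

HB.instance Definition _ := isMultiplicative.Build M M' induced_obj induced_objM.
HB.instance Definition _ :=
  Multiplicative_isUMagmaMorphism.Build M M' induced_obj induced_obj1.

Definition induced_obj_morphism : UMagmaMorphism.type M M' := induced_obj.

Definition induced_aut (a : M) (u : A a) : pullback induced_obj_morphism A' a :=
  Sval (fmap F (SHom u erefl : @hom (calS h) a a)).

Lemma Sval_fmap (a b : M) (u : @hom (calS h) a b) :
  Sval (fmap F u) = induced_aut (Sval u).
Proof. by case: u => u e; case: b / e. Qed.

Fact induced_aut_is_zmod_morphism (a : M) : zmod_morphism (@induced_aut a).
Proof.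
have D (u v : A a) : induced_aut (u + v) = induced_aut u + induced_aut v.
  have /(congr1 (@Sval _ _ _ _))/= := fmap_add F
    (SHom u erefl : @hom (calS h) a a) (SHom v erefl : @hom (calS h) a a).
  by rewrite (@cast_id _ A').
by move=> u v; apply/eqP; rewrite eq_sym subr_eq -D subrK.
Qed.
HB.instance Definition _ (a : M) := GRing.isZmodMorphism.Build
  (A a) (pullback induced_obj_morphism A' a) (@induced_aut a)
  (@induced_aut_is_zmod_morphism a).

Definition induced_aut_inv (a : M) (v : pullback induced_obj_morphism A' a) : A a :=
  Sval (lift (SHom (v : A' (induced_obj a)) erefl : @hom (calS h') (F a) (F a))).

Fact induced_autK (a : M) : cancel (@induced_aut a) (@induced_aut_inv a).
Proof.
move=> u; rewrite /induced_aut_inv.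
rewrite (_ : SHom _ _ = fmap F (SHom u erefl : @hom (calS h) a a)) ?fmapK //.
exact: Shom_inj.
Qed.

Fact induced_autVK (a : M) : cancel (@induced_aut_inv a) (@induced_aut a).
Proof. by move=> v; rewrite -Sval_fmap liftK. Qed.

Lemma induced_aut0 (a : M) : induced_aut (0 : A a) = (0 : A' (induced_obj a)).
Proof. exact: raddf0. Qed.

Fact induced_aut_natural (a b : M) (u : A a) :
  induced_aut (hmap b u)
  = hmap b (induced_aut u : pullback induced_obj_morphism A' a).
Proof.
have /(congr1 (@Sval _ _ _ _))/= := phi_natural F
  (SHom u erefl : @hom (calS h) a a) (Sid A b : @hom (calS h) b b).
rewrite !Sval_fmap /= induced_aut0 !raddf0 !addr0.
rewrite (@cast_id _ A') addrC => /addIr e.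
rewrite [hmap (induced_obj b) _]e cast_cast; exact/esym/(@cast_id _ A').
Qed.

Definition induced_hiso : hiso A (pullback induced_obj_morphism A') :=
  @HIso M A (pullback induced_obj_morphism A')
    (fun a => GRing.Additive.clone _ _ (@induced_aut a) _) induced_aut_inv
    induced_aut_natural induced_autK induced_autVK.

(** The cochain [phi F] is normalized only up to the component [phi0 F] at the
unit. Adding to it the image of [phi0 F] makes it normalized and keeps its
coboundary. *)
Let unit_term (a : M) : A' (induced_obj a) :=
  cast (mul1g (induced_obj a)) (hmap (induced_obj a) (Sval (phi0 F))).

Let induced_cochain2_fun (a b : M) : pullback induced_obj_morphism A' (a * b)%g :=
  cast (Seq (phi F a b)) (Sval (phi F a b)) + unit_term (a * b)%g.

Let cast_unit_term a b (e : a = b) :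
  cast (congr1 induced_obj e) (unit_term a) = unit_term b.
Proof. by case: b / e. Qed.

Let hmap_unit_term a b c (e : (induced_obj a * induced_obj b)%g = induced_obj c) :
  cast e (hmap (induced_obj b) (unit_term a)) = unit_term c.
Proof.
rewrite /unit_term hmap_cast cast_cast.
by apply: hmap_mul.
Qed.

Fact induced_cochain2_sym a b :
  cast (mulgC b a) (induced_cochain2_fun b a) = induced_cochain2_fun a b.
Proof.
have /(congr1 (@Sval _ _ _ _))/= := phi_comm F a b.
rewrite Sval_fmap /= induced_aut0 raddf0 addr0 add0r => e.
rewrite /induced_cochain2_fun castD !cast_pull -[Sval (phi F a b)]e.
congr (_ + _); last exact: cast_unit_term.
by rewrite !(@cast_cast _ A'); exact: (@cast_irr _ A').
Qed.

Fact induced_cochain2_1 a : induced_cochain2_fun a 1%g = 0.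
Proof.
have /(congr1 (@Sval _ _ _ _))/= := phi_runit F a.
rewrite Sval_fmap /= induced_aut0 !raddf0 !add0r => e.
apply: (@cast_inj _ A' _ _
  (etrans (congr1 induced_obj (mulg1 a)) (esym (mulg1 (induced_obj a))))).
rewrite cast0 -[RHS]e castD; congr (_ + _); rewrite (@cast_cast _ A').
  exact: (@cast_irr _ A').
by apply: cast_hmap_eq; rewrite mulg1.
Qed.

Definition induced_cochain2 : cochain2 (pullback induced_obj_morphism A') :=
  Cochain2 induced_cochain2_sym induced_cochain2_1.

Lemma induced_cochain2P a b c :
  (induced_aut (h a b c) : A' (induced_obj _))
    - cast (esym (gmulfM3 induced_obj_morphism a b c))
     (h' (induced_obj a) (induced_obj b) (induced_obj c))
  = partial2 induced_cochain2 a b c.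
Proof.
have /(congr1 (@Sval _ _ _ _))/= := phi_assoc F a b c.
rewrite !Sval_fmap /= ?induced_aut0.
rewrite (raddf0 (hmap _)) (raddf0 (cast _)) addr0.
rewrite (raddf0 (hmap _)) add0r.
move=> /(congr1 (@cast _ A' _ _ (esym (gmulfM3 induced_obj_morphism a b c)))).
rewrite !castD !(@cast_cast _ A') => E.
rewrite /partial2 !cast_pull !hmap_pull /=.
rewrite /induced_cochain2_fun !(raddfD (hmap _)) /= !castD.
apply: (coboundary_of_square (N := unit_term (a * b * c)%g) E);
  first exact: (@cast_id _ A').
- rewrite !(@cast_cast _ A') hmap_unit_term; congr (_ + _).
  by rewrite (@hmap_cast _ A') (@cast_cast _ A'); apply: (@cast_irr _ A').
- by congr (_ + _); apply: (@cast_irr _ A').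
- rewrite cast_unit_term !(@cast_cast _ A'); congr (_ + _).
  exact: (@cast_irr _ A').
- rewrite hmap_unit_term; congr (_ + _).
  by rewrite (@hmap_cast _ A') (@cast_cast _ A'); apply: (@cast_irr _ A').
Qed.
End CohomologousOfFunctor.


Lemma H3class_pushV_pull (M M' : comMonoidType) (A : hfunctor M)
    (A' : hfunctor M') (h : cocycle3 A) (h' : cocycle3 A')
    (i : UMagmaMorphism.type M M') (psi : hiso A (pullback i A')) :
  H3class h = H3_pushV psi (H3_pull i (H3class h')) <->
  exists g : cochain2 A, forall a b c, (h a b c
    - hiso_inv psi (cast (esym (gmulfM3 i a b c)) (h' (i a) (i b) (i c)))
    = partial2 g a b c)%R.
Proof. by rewrite H3_pullE [H3_pushV _ _]H3_pushE H3classP. Qed.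

Lemma calS_equivalent_iff (M M' : comMonoidType) (A : hfunctor M)
    (A' : hfunctor M') (h : cocycle3 A) (h' : cocycle3 A') :
  sm_equivalent (calS h) (calS h') <->
  exists (i : UMagmaMorphism.type M M') (psi : hiso A (pullback i A')),
    bijective i /\ H3class h = H3_pushV psi (H3_pull i (H3class h')).
Proof.
split=> [[F eqF]|[i [psi [i_bij /H3class_pushV_pull[g hg]]]]]; last first.
  by exists (cohomologous_smfunctor hg); apply: cohomologous_sm_equivalence.
have [lift [fmapK liftK]] := sm_equivalence_lift eqF.
exists (induced_obj_morphism F), (induced_hiso fmapK liftK); split.
  case: eqF => G [[theta _] [theta' _]].
  by exists (induced_obj G) => x; [exact: Seq (theta x) | exact: Seq (theta' x)].
apply/H3class_pushV_pull.
exists (push_cochain2 (hiso_sym (induced_hiso fmapK liftK))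
  (induced_cochain2 F)) => a b c.
rewrite partial2_push -induced_cochain2P raddfB /=; congr (_ - _)%R.
exact/esym/induced_autK.
Qed.


(** * The monoid of isomorphism classes *)

Section IsoClasses.
Variable C : ssmag.

Definition isomorphic (x y : {classic C}) : bool :=
  `[< inhabited (hom (x : C) (y : C)) >].

Fact isomorphic_refl : reflexive isomorphic.
Proof. by move=> x; apply/asboolP; exists; exact: \0_(x : C). Qed.

Fact isomorphic_sym : symmetric isomorphic.
Proof.
by move=> x y; apply/asboolP/asboolP => -[u]; exists; exact: (- u).
Qed.

Fact isomorphic_trans : transitive isomorphic.
Proof.
move=> y x z /asboolP[u] /asboolP[v]; apply/asboolP; exists; exact: (v + u).
Qed.

Canonical isomorphic_equiv := EquivRel isomorphic
  isomorphic_refl isomorphic_sym isomorphic_trans.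

Definition iso_class := {eq_quot isomorphic_equiv}.
HB.instance Definition _ := Choice.on iso_class.

(** The chosen representatives are the objects of a skeleton. *)
Definition class_obj (a : iso_class) : C := repr a.
Definition iso_cl (x : C) : iso_class := \pi x.

Lemma eq_iso_cl (x y : C) (u : hom x y) : iso_cl x = iso_cl y.
Proof. by apply/eqmodP/asboolP; exists. Qed.

Definition to_class_obj (x : C) : hom x (class_obj (iso_cl x)).
Proof.
suff /cid[] : exists _ : hom x (class_obj (iso_cl x)), True by [].
have /eqmodP/asboolP[u] : iso_cl x = iso_cl (class_obj (iso_cl x))
  by rewrite [RHS]reprK.
by exists u.
Defined.

Lemma class_objK (a : iso_class) : iso_cl (class_obj a) = a.
Proof. exact: reprK. Qed.

Definition iso_mul (a b : iso_class) : iso_class :=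
  iso_cl (class_obj a ⊗ class_obj b).
Definition iso_one : iso_class := iso_cl unito.

Fact iso_mulA : associative iso_mul.
Proof.
move=> a b c; apply/eq_iso_cl.
exact: ((to_class_obj _) ⊠ \0_(class_obj c) + - assoc _ _ _
  + \0_(class_obj a) ⊠ (- to_class_obj _)).
Qed.

Fact iso_mulC : commutative iso_mul.
Proof. by move=> a b; apply/eq_iso_cl; exact: comm. Qed.

Fact iso_mulg1 : right_id iso_one iso_mul.
Proof.
move=> a; rewrite -[RHS]class_objK; apply/eq_iso_cl.
exact: (runit _ + \0_(class_obj a) ⊠ (- to_class_obj unito)).
Qed.

Fact iso_mul1g : left_id iso_one iso_mul.
Proof. by move=> a; rewrite iso_mulC iso_mulg1. Qed.

HB.instance Definition _ := isMonoid.Build iso_class iso_mulA iso_mul1g iso_mulg1.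
HB.instance Definition _ := Monoid_isCommutative.Build iso_class iso_mulC.

Definition iso_monoid : comMonoidType := iso_class.

End IsoClasses.


(** * Symmetric and unital choice of structure maps *)

Section Transport.
Variables (C : ssmag) (M : comMonoidType) (obj : M -> C).
Implicit Types a b c : M.

Definition transp a b (e : a = b) : hom (obj a) (obj b) :=
  let: erefl := e in \0_(obj a).

Lemma transp_id a (e : a = a) : transp e = \0_(obj a).
Proof. by rewrite (eq_irrelevance e erefl). Qed.

Lemma transpD a b c (e : b = c) (e' : a = b) :
  transp e + transp e' = transp (etrans e' e).
Proof. by case: c / e; rewrite add0m. Qed.

Lemma transp_irr a b (e e' : a = b) : transp e = transp e'.
Proof. by rewrite (eq_irrelevance e e'). Qed.
End Transport.

(** The isomorphisms [obj a ⊗ obj b -> obj (a * b)] can be chosen compatibly with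
the symmetry: take an arbitrary one for one of the two orders of each pair and
deduce the other from the symmetry. This is consistent because the symmetry is
involutive, and because it is the identity on [obj a ⊗ obj a]. If [1] occurs in
the pair, the isomorphism is imposed by the unit constraint. *)
Section Symmetrization.
Variables (C : ssmag) (M : comMonoidType) (obj : M -> C).
Variable f0 : hom unito (obj 1%g).
Variable p : forall a b : M, hom (obj a ⊗ obj b) (obj (a * b)%g).
Implicit Types a b c : M.
Let axC := ssmag_axioms C.
Local Notation transp := (@transp C M obj).

Let unital a b : hom (obj a ⊗ obj b) (obj (a * b)%g) :=
  match b =P 1%g with
  | ReflectT e => transp (esym (etrans (congr1 (mul a) e) (mulg1 a)))
      + (runit (obj a) + (\0_(obj a) ⊠ (- f0 + transp e)))
  | ReflectF _ => p a b
  end.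

Let unital1 a :
  transp (mulg1 a) + (unital a 1%g + \0_(obj a) ⊠ f0) = runit (obj a).
Proof.
rewrite /unital; case: eqP => // e; rewrite (transp_id _ e) addm0 !addmA transpD.
by rewrite transp_id add0m -addmA tensmD addNm addm0 tensm0 addm0.
Qed.

(** Selects one order of each unordered pair. The choice operator depends on a
predicate only through its extension, so that it picks the same element from the
pairs [(a, b), (b, a)] and [(b, a), (a, b)]; the unit is kept on the right. *)
Definition preferred a b : bool :=
  (b == 1%g) || (a != 1%g) && (choose (pred2 (a, b) (b, a)) (a, b) == (a, b)).

Lemma choose_pairC a b :
  choose (pred2 (b, a) (a, b)) (b, a) = choose (pred2 (a, b) (b, a)) (a, b).
Proof.
rewrite (eq_choose (Q := pred2 (a, b) (b, a))) => [|x /=]; last by rewrite orbC.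
by apply: choose_id; rewrite /= eqxx ?orbT.
Qed.

Lemma preferred_total a b : preferred a b || preferred b a.
Proof.
rewrite /preferred (choose_pairC a b); have [//|b1] /= := eqVneq b 1%g.
have [//|a1] /= := eqVneq a 1%g.
exact: (@chooseP _ (pred2 (a, b) (b, a)) (a, b) (predU1l _ erefl)).
Qed.

Lemma preferred_anti a b : preferred a b -> preferred b a -> a = b.
Proof.
rewrite /preferred (choose_pairC a b); have [->|b1] /= := eqVneq b 1%g.
  by rewrite orbF => _ /eqP.
by have [//|a1] /= := eqVneq a 1%g; move=> /eqP-> /eqP[].
Qed.

Let sym a b : hom (obj a ⊗ obj b) (obj (a * b)%g) :=
  if preferred a b then unital a b
  else transp (mulgC b a) + (unital b a + comm (obj a) (obj b)).

Lemma exists_symmetric_unital :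
  exists f : forall a b, hom (obj a ⊗ obj b) (obj (a * b)%g),
  (forall a, transp (mulg1 a) + (f a 1%g + \0_(obj a) ⊠ f0) = runit (obj a)) /\
  (forall a b, f b a + comm (obj a) (obj b) = transp (mulgC a b) + f a b).
Proof.
exists sym; split=> [a|a b].
  by rewrite /sym /preferred eqxx unital1.
rewrite /sym; have [ab|ab] := boolP (preferred a b); last first.
  have := preferred_total a b; rewrite (negPf ab) => /= ->.
  by rewrite addmA transpD transp_id add0m.
have [ba|ba] := boolP (preferred b a); last first.
  by rewrite -!addmA (comm_sym axC) addm0.
have e := preferred_anti ab ba; case: b / e {ab ba}.
by rewrite (comm_strict axC) addm0 transp_id add0m.
Qed.
End Symmetrization.


(** * The cocycle of a skeleton *)

Section AutGroup.
Variables (C : ssmag) (x : C).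

(** A copy of [hom x x] that carries its abelian group structure. *)
Definition autg := hom x x.

HB.instance Definition _ := gen_eqMixin autg.
HB.instance Definition _ := gen_choiceMixin autg.

Fact autgA : associative (fun u v : autg => u + v : autg).
Proof. by move=> u v w; rewrite addmA. Qed.
Fact autgC : commutative (fun u v : autg => u + v : autg).
Proof. exact: ssmag_abelian. Qed.
Fact autg0 : left_id (\0_x : autg) (fun u v : autg => u + v : autg).
Proof. exact: add0m. Qed.
Fact autgN :
  left_inverse (\0_x : autg) (fun u : autg => - u) (fun u v : autg => u + v : autg).
Proof. exact: addNm. Qed.
HB.instance Definition _ := GRing.isZmodule.Build autg autgA autgC autg0 autgN.
End AutGroup.

(** The primed variables stand for the same elements as the unprimed ones, reached
by transports along other proofs of the same equality. *)
Lemma cocycle_of_pentagon (V : zmodType) (x y z t u x' z' t' : V) :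
  (t + y = x + z + u -> x' = x -> z' = z -> t' = t ->
   x' - y + z' - t' + u = 0)%R.
Proof.
move=> e -> -> ->; apply/eqP.
by rewrite addrAC subr_eq0 addrAC -addrA addrAC subr_eq e addrA addrAC.
Qed.

(** The identities of a symmetric cocycle are those given by the pentagon, the
hexagon and the triangle when the symmetry and the unit constraints vanish. *)
Section CocycleOfCoherence.
Variables (M : comMonoidType) (A : hfunctor M).
Variable h : forall a b c : M, A (a * b * c)%g.
Local Open Scope group_scope.
Local Open Scope ring_scope.
Hypothesis hexagon_h : forall a b c (e : (b * a * c = a * b * c)%g),
  cast e (h b a c) = cast (mulg_rot a b c) (h b c a) + h a b c.
Hypothesis triangle_h : forall a b, h a 1%g b = 0.
Hypothesis pentagon_h : forall a b c d, partial3 h a b c d = 0.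

(** The hexagons for [a, c, b] and [c, a, b] express [h c a b] and [h a c b] in
terms of each other; adding them up cancels both. *)
Lemma hexagon_rev a b c : cast (mulg_rev a b c) (h c b a) + h a b c = 0.
Proof.
have e1 : (c * a * b = a * c * b)%g by rewrite (mulgC c).
apply: (@cast_inj _ A _ _ (mulgAC a c b)); rewrite cast0 castD cast_cast.
apply: (addIr (h a c b)); rewrite add0r addrAC.
have := congr1 (cast e1) (hexagon_h (esym e1)).
rewrite castD !cast_cast cast_id (hexagon_h e1) addrC => e.
by rewrite [RHS]e; congr (_ + (_ + _)); apply: cast_irr.
Qed.

(** By the hexagon, the sum of two of the terms is [h b a c], which is the opposite
of the third one. *)
Lemma hexagon_rot a b c :
  h a b c + cast (mulg_rot a b c) (h b c a) + cast (mulg_rotl a b c) (h c a b) = 0.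
Proof.
have e : (b * a * c = a * b * c)%g by rewrite (mulgC a).
rewrite (addrC (h a b c)) -(hexagon_h e).
have := congr1 (cast e) (hexagon_rev b a c).
rewrite castD cast0 cast_cast addrC => <-.
by congr (_ + _); apply: cast_irr.
Qed.

(** In the pentagon for [a, b, 1, 1], two terms vanish by the triangle and two
others cancel, leaving the image of [h a b 1] under [1_*]. *)
Lemma pentagon_unit a b : h a b 1%g = 0.
Proof.
have := pentagon_h a b 1%g 1%g.
rewrite /partial3 !triangle_h !raddf0 ?oppr0 addr0 add0r.
have -> : cast (mulgA4 a b 1%g 1%g) (h a (b * 1)%g 1%g)
        = cast (mulgA (a * b)%g 1%g 1%g) (h a b (1 * 1)%g).
  by apply: cast_fam3; rewrite ?mulg1.
rewrite subrr add0r => E.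
by rewrite -[LHS](hmap1) E raddf0.
Qed.

Definition coherent_cochain3 : cochain3 A :=
  Cochain3 hexagon_rev hexagon_rot pentagon_unit.

Fact coherent_cochain3_cocycle : coherent_cochain3 \in @is_cocycle3 M A.
Proof. exact/asboolP/pentagon_h. Qed.

Definition coherent_cocycle3 : cocycle3 A := Cocycle3 coherent_cochain3_cocycle.
End CocycleOfCoherence.

(** Given a representative [obj a] of each element of [M] and structure maps
[f a b : obj a ⊗ obj b -> obj (a * b)] compatible with the unit and the symmetry,
the coefficients are the groups of automorphisms of the representatives, [b_*]
is [- ⊗ obj b] conjugated by [f], and the cocycle is the associator read through
[f]. As conjugations by parallel arrows agree, the functor laws of [b_*] amount to
naturality of the constraints of [C]. *)
Section Skeleton.
Variables (C : ssmag) (M : comMonoidType) (obj : M -> C).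
Variable f0 : hom unito (obj 1%g).
Variable f : forall a b : M, hom (obj a ⊗ obj b) (obj (a * b)%g).
Implicit Types a b c d : M.
Let axC := ssmag_axioms C.
Let abC := @ssmag_abelian C.
Local Notation transp := (@transp C M obj).
Hypothesis f_runit :
  forall a, transp (mulg1 a) + (f a 1%g + \0_(obj a) ⊠ f0) = runit (obj a).
Hypothesis f_comm : forall a b,
  f b a + comm (obj a) (obj b) = transp (mulgC a b) + f a b.

Lemma castE a b (e : a = b) (u : autg (obj a)) :
  cast (A := fun a => autg (obj a)) e u = conjm (transp e) u.
Proof. by case: b / e; apply/esym/conjm_swap; rewrite add0m addm0. Qed.

Definition skel_hmap a b (u : autg (obj a)) : autg (obj (a * b)%g) :=
  conjm (f a b) (u ⊠ \0_(obj b)).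

Fact skel_hmap_is_zmod_morphism a b : zmod_morphism (@skel_hmap a b).
Proof.
have D u v : skel_hmap b (u + v : autg (obj a))%R
    = (skel_hmap b u + skel_hmap b v)%R.
  by rewrite /skel_hmap /GRing.add /= tensm_addl conjmD.
by move=> u v; apply/eqP; rewrite eq_sym subr_eq -D subrK.
Qed.
HB.instance Definition _ a b := GRing.isZmodMorphism.Build
  (autg (obj a)) (autg (obj (a * b)%g)) (@skel_hmap a b)
  (@skel_hmap_is_zmod_morphism a b).

Let conjm_tensl (x y z : C) (g : hom x y) u :
  conjm g u ⊠ \0_z = conjm (g ⊠ \0_z) (u ⊠ \0_z).
Proof. by rewrite -conjm_tensm conjm0. Qed.

Let tens_conjm (x y z : C) (g : hom y z) (u : hom x x) :
  conjm (\0_x ⊠ g) (u ⊠ \0_y) = u ⊠ \0_z.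
Proof. by apply: conjm_swap; rewrite !tensmD !(addm0, add0m). Qed.

Let assoc_conjm (x y z : C) (u : hom x x) :
  conjm (assoc x y z) ((u ⊠ \0_y) ⊠ \0_z) = u ⊠ \0_(y ⊗ z).
Proof. by apply: conjm_swap; rewrite (assoc_natural axC) tensm0. Qed.

Let comm_conjm (x y : C) (u : hom x x) :
  conjm (comm x y) (u ⊠ \0_y) = \0_y ⊠ u.
Proof. by apply: conjm_swap; rewrite (comm_natural axC). Qed.

Let runit_conjm (x : C) (u : hom x x) :
  conjm (runit x) (u ⊠ \0_unito) = u.
Proof. by apply: conjm_swap; rewrite (runit_natural axC). Qed.

Fact skel_hmap1 a (u : autg (obj a)) :
  cast (A := fun a => autg (obj a)) (mulg1 a) (skel_hmap 1%g u) = u.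
Proof.
rewrite castE /skel_hmap -(tens_conjm f0) !conjm_comp f_runit.
exact: runit_conjm.
Qed.

Fact skel_hmapM a b c (u : autg (obj a)) :
  skel_hmap c (skel_hmap b u)
  = cast (A := fun a => autg (obj a)) (mulgA a b c) (skel_hmap (b * c)%g u).
Proof.
rewrite castE /skel_hmap conjm_tensl -(tens_conjm (f b c)) -assoc_conjm.
by rewrite !conjm_comp; apply: conjm_indep.
Qed.

Definition skel_hfunctor : hfunctor M :=
  @HFunctor M (fun a => autg (obj a)) (fun a b => @skel_hmap a b)
    skel_hmap1 skel_hmapM.

Local Notation A := skel_hfunctor.

Definition skel_cochain a b c : A (a * b * c)%g :=
  (transp (mulgA a b c) + (f a (b * c)%g + ((\0_(obj a) ⊠ f b c)
    + (assoc (obj a) (obj b) (obj c)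
    + (- (f a b ⊠ \0_(obj c)) + - f (a * b)%g c)))))%hom.

(** The groupoid of [skel_cochain], before the latter is known to be a cocycle:
the coherence conditions reflected from [C] to it prove that it is one. *)
Definition skel_data : smdata :=
  @SMData (Sgpd A) (fun a b => a * b)%g (@Stensm M A) 1%g
    (fun a b c => SHom (skel_cochain a b c) (esym (mulgA a b c)))
    (fun a => SHom 0%R (mulg1 a)) (fun a b => SHom 0%R (mulgC a b)).

Definition skel_map (a b : M) (u : Shom A a b) : hom (obj a) (obj b) :=
  transp (Seq u) + Sval u.

Fact skel_map_id (a : M) : skel_map (Sid A a) = \0_(obj a).
Proof. exact: addm0. Qed.

Fact skel_map_add (a b c : M) (v : Shom A b c) (u : Shom A a b) :
  skel_map (Sadd v u) = skel_map v + skel_map u.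
Proof.
case: u v => u e [v e']; case: c / e'; case: b / e v => v /=.
by rewrite /skel_map /= !add0m.
Qed.

Definition skel_inclusion : functor (Sgpd A) C :=
  @Functor (Sgpd A) C obj skel_map skel_map_id skel_map_add.

Definition skel_lift (a b : M) (e : a = b) (u : hom (obj a) (obj b)) :
  Shom A a b := @SHom M A a b (- transp e + u)%hom e.

Lemma skel_liftK (a b : M) (e : a = b) : cancel (skel_lift e) (@skel_map a b).
Proof. by move=> u; rewrite /skel_map /= addmA addmN add0m. Qed.

Lemma skel_mapK (a b : M) (e : a = b) : cancel (@skel_map a b) (skel_lift e).
Proof.
by move=> u; apply: Shom_inj; rewrite /= /skel_map (transp_irr _ e (Seq u)) addKm.
Qed.

Lemma skel_map_inj (a b : M) : injective (@skel_map a b).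
Proof. by move=> u v; apply: (can_inj (skel_mapK (Seq u))). Qed.

(** The second summand of [Stensm u v] is [v ⊠ \0_x] conjugated by [f y x] and
carried along [mulgC]; as conjugations by parallel arrows agree, it is also
[\0_x ⊠ v] conjugated by [f x y]. *)
Lemma skel_natural (x x' y y' : M) (u : Shom A x x') (v : Shom A y y') :
  f x' y' + skel_map u ⊠ skel_map v = skel_map (Stensm u v) + f x y.
Proof.
case: u v => u e [v e']; case: x' / e; case: y' / e'.
rewrite /skel_map /= !add0m castE.
rewrite [transp _]transp_id add0m /skel_hmap conjm_comp.
rewrite (conjm_indep abC _ (f x y + comm (obj y) (obj x))) -conjm_comp.
by rewrite comm_conjm /GRing.add /= -conjmD tensm_split conjmP.
Qed.

Lemma skel_assoc (x y z : M) :
  skel_map (assoc (s := skel_data) x y z) + (f (x * y)%g z + f x y ⊠ \0_(obj z))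
  = f x (y * z)%g + (\0_(obj x) ⊠ f y z + assoc (obj x) (obj y) (obj z)).
Proof.
rewrite /skel_map /= /skel_cochain.
by rewrite !addmA transpD transp_id add0m addmNK addmNK.
Qed.

Lemma skel_runit x :
  skel_map (runit (s := skel_data) x) + (f x 1%g + \0_(obj x) ⊠ f0)
  = runit (obj x).
Proof. by rewrite /skel_map /= addm0 f_runit. Qed.

Lemma skel_comm x y :
  f y x + comm (obj x) (obj y) = skel_map (comm (s := skel_data) x y) + f x y.
Proof. by rewrite /skel_map /= addm0 f_comm. Qed.

Local Open Scope ring_scope.

Lemma skel_cochain_hexagon a b c (e : (b * a * c = a * b * c)%g) :
  cast (A := A) e (skel_cochain b a c)
  = cast (A := A) (mulg_rot a b c) (skel_cochain b c a) + skel_cochain a b c.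
Proof.
have := @reflect_hexagon skel_data C skel_inclusion f skel_map_inj skel_natural
  skel_assoc skel_comm a b c.
move/(congr1 (@Sval _ _ _ _)) => /=.
rewrite !raddf0 ?addr0 raddf0 add0r cast_cast => E.
rewrite (cast_irr _ (esym (congr2 mul (mulgC a b) (erefl c)))) E.
by congr (_ + _); exact: cast_irr.
Qed.

Lemma skel_cochain_mid a b : skel_cochain a 1%g b = 0.
Proof.
have := @reflect_triangle skel_data C skel_inclusion f f0 skel_map_inj skel_natural
  skel_assoc skel_runit skel_comm a b.
move/(congr1 (@Sval _ _ _ _)) => /=.
by rewrite !raddf0 ?addr0 !raddf0 add0r.
Qed.

Lemma skel_cochain_pentagon a b c d : partial3 skel_cochain a b c d = 0.
Proof.
have := @reflect_pentagon skel_data C skel_inclusion f skel_map_inj skel_natural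
  skel_assoc a b c d.
move/(congr1 (@Sval _ _ _ _)) => /=.
rewrite !raddf0 ?add0r ?addr0 !castD !cast_cast => E.
by apply: cocycle_of_pentagon E _ _ _; apply: cast_irr.
Qed.

Local Open Scope hom_scope.

Definition skel_cocycle : cocycle3 A := coherent_cocycle3
  skel_cochain_hexagon skel_cochain_mid skel_cochain_pentagon.

Definition skel_smfunctor : smfunctor (calS skel_cocycle) C.
Proof.
apply: (@SMFunctor (calS skel_cocycle) C skel_inclusion f f0).
- exact: skel_natural.
- move=> x y z; apply: etrans (esym (addmA _ _ _)) _.
  exact: etrans (skel_assoc x y z) (addmA _ _ _).
- by move=> x; apply: etrans (esym (addmA _ _ _)) (skel_runit x).
- exact: skel_comm.
Defined.

(** Essential surjectivity is given by [ob] and [eps]; full faithfulness holds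
since the representatives of distinct elements are not isomorphic. *)
Lemma skel_sm_equivalence (ob : C -> M) (eps : forall y, hom (obj (ob y)) y) :
  (forall a b, hom (obj a) (obj b) -> a = b) -> sm_equivalence skel_smfunctor.
Proof.
move=> obj_inj.
apply: (@fully_faithful_sm_equivalence _ _ skel_smfunctor ob eps
  (fun a b u => skel_lift (obj_inj a b u) u)).
  move=> a b u; exact: skel_mapK.
move=> a b u; exact: skel_liftK.
Qed.
End Skeleton.

Lemma calS_essentially_surjective (C : ssmag) :
  exists (M : comMonoidType) (A : hfunctor M) (h : cocycle3 A),
    sm_equivalent (calS h) C.
Proof.
have [f [f_runit f_comm]] :=
  @exists_symmetric_unital C (iso_monoid C) (@class_obj C) (to_class_obj unito)
    (fun a b => to_class_obj (class_obj a ⊗ class_obj b)).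
exists (iso_monoid C), _, (skel_cocycle f_runit f_comm).
exists (skel_smfunctor f_runit f_comm).
apply: (@skel_sm_equivalence _ _ _ _ _ _ _ (@iso_cl C) (fun y => - to_class_obj y)).
by move=> a b u; rewrite -[a]class_objK -[b]class_objK; exact: eq_iso_cl u.
Qed.

Theorem theorem3p1 :
  (forall C : ssmag,
     exists (M : comMonoidType) (A : hfunctor M) (h : cocycle3 A),
       sm_equivalent (calS h) C)
  /\
  (forall (M M' : comMonoidType) (A : hfunctor M) (A' : hfunctor M')
          (h : cocycle3 A) (h' : cocycle3 A'),
     sm_equivalent (calS h) (calS h') <->
     exists (i : UMagmaMorphism.type M M') (psi : hiso A (pullback i A')),
       bijective i /\
       H3class h = H3_pushV psi (H3_pull i (H3class h'))).
Proof.
split; [exact: calS_essentially_surjective | exact: calS_equivalent_iff].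
Qed.
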